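(* Assume the setting and standing assumptions given in the context, let $T\ge 0$ be the number from assumption (ii), and let $t_1>T$. Consider the sequence of functions $$\{e^{-\lambda_jt}b_j,\ t\in[0,t_1-T]\},\quad j=1,2,\dots,\qquad(\star)$$ in $L_2[0,t_1-T]$, where $b_j=(b,\psi_j)$. (Necessity) If the equation $\dot x(t)=Ax(t)+bu(t)$, $x(0)=x_0$, is exact null-controllable on $[0,t_1]$ by controls vanishing after time moment $t_1-T$, then the sequence $(\star)$ is minimal. (Sufficiency) If the sequence $(\star)$ is strongly minimal and $$\sum_{j=1}^\infty|(x_0,\psi_j)|^2<+\infty\quad\text{for all }x_0\in X,$$ then the equation is exact null-controllable on $[0,t_1]$ by controls vanishing after time moment $t_1-T$.
   Context: Setting: $X$ is a separable complex Hilbert space; $A$ is the infinitesimal generator of a strongly continuous ($C_0$) semigroup $S(t)$ on $X$. $W\subset X\subset V$ are Hilbert spaces with continuous dense injections, where $W=D(A^* )$ with the graph norm and $V=W^*$ is its dual with respect to the pivot space $X$. For each $t\ge 0$, $S(t)$ extends uniquely to a bounded operator $\mathcal S(t)$ on $V$, and $\mathcal S(t)$ is a $C_0$-semigroup on $V$ whose generator extends $A$ and has domain $X$. The control space is $U=\mathbb C$ (one input), and the (possibly unbounded) input operator is $u\mapsto bu$ with a fixed $b\in V$. $(\cdot,\cdot)$ denotes the inner product of $X$ and also its extension to the duality pairing of $V$ with $W$. The mild solution of $\dot x(t)=Ax(t)+bu(t)$, $x(0)=x_0\in X$, is $x(t,x_0,u(\cdot))=S(t)x_0+\int_0^t\mathcal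 S(t-\tau)bu(\tau)\,d\tau$ (Bochner integral in $V$). It is assumed that $\int_0^t\mathcal S(t-\tau)bu(\tau)\,d\tau\in X$ for all $u(\cdot)\in L_2^{\rm loc}[0,+\infty)$ and $t\ge0$. Standing assumptions on $A$: (i) $A$ has purely point spectrum $\sigma$ with no finite limit points, and all eigenvalues have (algebraic) multiplicity $1$. (ii) There exists $T\ge0$ such that every mild solution of $\dot x(t)=Ax(t)$ expands in a series of eigenvectors of $A$ which converges uniformly in $t\in[T_1,T_2]$ for any $T<T_1<T_2$. Notation: $\lambda_j$, $j=1,2,\dots$, are the eigenvalues of $A$, enumerated in order of non-decreasing absolute value; $\varphi_j$ and $\psi_j$ are corresponding eigenvectors of $A$ and $A^*$ ($A\varphi_j=\lambda_j\varphi_j$, $A^*\psi_j=\overline{\lambda_j}\psi_j$), normalized so that $(\varphi_k,\psi_j)=\delta_{kj}$. The number $b_j=(b,\psi_j)$ is well defined since $\psi_j\in W$, $b\in V$. $L_2[0,s]$ is the space of complex-valued square integrable functions. Definition: the equation is exact null-controllable on $[0,t_1]$ by controls vanishing after time moment $t_2$ if for each $x_0\in X$ there is a control $u(\cdot)\in L_2[0,t_2]$, with $u(t)=0$ a.e. on $[t_2,+\infty)$, such that $x(t_1,x_0,u(\cdot))=0$. Definitions for a sequence $\{x_j\}_{j\ge1}$ in a Hilbert space: it is minimal if for each $j$, $x_j\notin\overline{\mathrm{span}}\{x_k: k\ne j\}$. It is strongly minimal if $\lim_{n\to\infty}\gamma_n^{\min}>0$, where $\gamma_n^{\min}$ is the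 minimal eigenvalue of the Gram matrix $\{(x_i,x_j)\}_{i,j=1}^n$ (a non-increasing nonnegative sequence). *)

(* Defs.v *)
From HB Require Import structures.
From mathcomp Require Import all_boot all_order all_algebra.
From mathcomp Require Import all_classical all_reals all_analysis.
From mathcomp Require Import complex.

Set Implicit Arguments.
Unset Strict Implicit.
Unset Printing Implicit Defensive.

Import Order.TTheory GRing.Theory Num.Theory.
Import numFieldNormedType.Exports.

Local Open Scope classical_set_scope.
Local Open Scope ring_scope.

(* Norms in a module over R[i] are R[i]-valued (with zero imaginary part).    *)
Definition rnorm (R : realType) (V : normedModType R[i]) (v : V) : R :=
  complex.Re `|v|.

Definition cexp (R : realType) (z : R[i]) : R[i] :=
  Complex (expR (complex.Re z) * cos (complex.Im z))
          (expR (complex.Re z) * sin (complex.Im z)).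

(* Complex Hilbert spaces: [hdot] is linear in its first argument and
   conjugate-linear in the second one, and induces the (complete) norm.       *)
HB.mixin Record isHilbert (R : realType) H
    of CompleteNormedModule R[i] H := {
  hdot : {dot H for (@Num.conj R[i])};
  hdot_norm : forall x : H, `|x| ^+ 2 = hdot x x
}.

#[short(type="hilbertType")]
HB.structure Definition Hilbert (R : realType) :=
  {H of isHilbert R H & CompleteNormedModule R[i] H}.

Definition separable_space (T : topologicalType) :=
  exists2 D : set T, countable D & dense D.

Section operators.
Context {R : realType}.
Local Notation C := R[i].

Definition bounded_linear (E F : normedModType C) (f : E -> F) :=
  linear f /\ continuous f.

Record c0_semigroup (E : normedModType C) (S : R -> E -> E) : Prop := {
  c0_bounded : forall t, 0 <= t -> bounded_linear (S t);
  c0_id : forall x, S 0 x = x;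
  c0_add : forall s t x, 0 <= s -> 0 <= t -> S (s + t) x = S s (S t x);
  c0_cont : forall x, S t x @[t --> (0 : R)^'+] --> x }.

(* Unbounded operators are represented by their graphs: [A x y] means that
   x belongs to the domain of A and A x = y.                                  *)
Definition opgraph (E : Type) := E -> E -> Prop.

Definition opdom (E : Type) (A : opgraph E) : set E :=
  [set x | exists y, A x y].

Definition generator (E : normedModType C) (S : R -> E -> E) : opgraph E :=
  fun x y => (real_complex R h^-1) *: (S h x - x) @[h --> (0 : R)^'+] --> y.

(* A single-valued relation as soon as the domain of A is dense.              *)
Definition adjoint (X : hilbertType R) (A : opgraph X) : opgraph X :=
  fun y z => forall x Ax, A x Ax -> hdot Ax y = hdot x z.

Definition resolvent_set (E : normedModType C) (A : opgraph E) : set C :=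
  [set z | exists B : E -> E, [/\ bounded_linear B,
     forall x y, A x y -> B (z *: x - y) = x &
     forall y, A (B y) (z *: B y - y)]].

Definition spectrum (E : normedModType C) (A : opgraph E) : set C :=
  ~` resolvent_set A.

Definition point_spectrum (E : normedModType C) (A : opgraph E) : set C :=
  [set z | exists2 x, x != 0 & A x (z *: x)].

(* [root_vector A z k x] : x belongs to the kernel of (A - z)^k.              *)
Fixpoint root_vector (E : normedModType C) (A : opgraph E) (z : C) (k : nat)
    (x : E) : Prop :=
  if k is k'.+1 then exists2 y, A x y & root_vector A z k' (y - z *: x)
  else x = 0.

(* The algebraic multiplicity of z is the dimension of its root subspace, the
   union over k of the kernels of (A - z)^k.                                  *)
Definition alg_multiplicity_one (E : normedModType C) (A : opgraph E) (z : C) :=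
  exists2 e, e != 0 &
    [set x | exists k, root_vector A z k x] = [set c *: e | c in [set: C]].

Record simple_point_spectrum (E : normedModType C) (A : opgraph E) : Prop := {
  spectrum_point : spectrum A = point_spectrum A;
  spectrum_discrete : limit_point (spectrum A : set C^o) = set0;
  spectrum_simple : forall z, point_spectrum A z -> alg_multiplicity_one A z }.

(* Every mild solution t |-> S(t)x of x' = Ax is, for t > T, the sum of a
   series of eigenvectors c_j(t) phi_j, uniformly on [T1, T2] for all
   T < T1 < T2.                                                               *)
Definition eigen_expansion (E : normedModType C) (S : R -> E -> E)
    (phi : nat -> E) (T : R) :=
  forall x, exists c : nat -> R -> C, forall T1 T2 : R, T < T1 -> T1 < T2 ->
    {uniform `[T1, T2],
      (fun n : nat => fun t : R => \sum_(j < n) c j t *: phi j) @ \oo -->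
      (fun t : R => S t x)}.

(* W = D(A^* ) with the graph norm, and V is the space of continuous antilinear
   functionals on W with the dual norm, X being the pivot space. The
   inclusions are the maps iW and iV; [pair v w] is the extension to V x W of
   the inner product of X.                                                    *)
Record pivot_triple (W X V : hilbertType R) (A : opgraph X)
    (iW : W -> X) (iV : X -> V) (pair : V -> W -> C) : Prop := {
  iW_linear : bounded_linear iW;
  iW_inj : injective iW;
  iW_dense : dense (range iW);
  iW_range : range iW = opdom (adjoint A);
  W_graph_norm : forall w z, adjoint A (iW w) z ->
    `|w| ^+ 2 = `|iW w| ^+ 2 + `|z| ^+ 2;
  iV_linear : bounded_linear iV;
  iV_inj : injective iV;
  iV_dense : dense (range iV);
  pair_linear : forall w a v1 v2,
    pair (a *: v1 + v2) w = a * pair v1 w + pair v2 w;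
  pair_antilinear : forall v a w1 w2,
    pair v (a *: w1 + w2) = Num.conj a * pair v w1 + pair v w2;
  pair_bound : forall v w, `|pair v w| <= `|v| * `|w|;
  pair_dual_norm : forall v (M : C), 0 <= M ->
    (forall w, `|pair v w| <= M * `|w|) -> `|v| <= M;
  pair_onto : forall f : W -> C^o, continuous f ->
    (forall a w1 w2, f (a *: w1 + w2) = Num.conj a * f w1 + f w2) ->
    exists v, forall w, pair v w = f w;
  pair_pivot : forall x w, pair (iV x) w = hdot x (iW w) }.

End operators.

Section bochner.
Context {R : realType}.
Local Notation mu := (@lebesgue_measure R).

Record step (V : normedModType R[i]) := Step {
  step_size : nat;
  step_set : 'I_step_size -> set R;
  step_val : 'I_step_size -> V;
  step_measurable : forall i, measurable (step_set i) }.

Definition step_fun (V : normedModType R[i]) (s : step V) (x : R) : V :=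
  \sum_(i < step_size s | `[< step_set i x >]) step_val i.

Definition step_integral (V : normedModType R[i]) (D : set R) (s : step V) : V :=
  \sum_(i < step_size s)
    real_complex R (fine (mu (D `&` step_set i))) *: step_val i.

(* f is Bochner integrable on D, a set of finite measure, and its integral
   over D is v.                                                               *)
Definition is_bochner_integral (V : normedModType R[i]) (D : set R)
    (f : R -> V) (v : V) :=
  exists s : nat -> step V, [/\
    {ae mu, forall x, D x -> step_fun (s n) x @[n --> \oo] --> f x},
    (\int[mu]_(x in D) (rnorm (f x - step_fun (s n) x))%:E)%E
      @[n --> \oo] --> 0%E &
    step_integral D (s n) @[n --> \oo] --> v].

End bochner.

Section L2.
Context {R : realType}.
Local Notation C := R[i].
Local Notation mu := (@lebesgue_measure R).

Definition in_L2 (s : R) (u : R -> C) :=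
  [/\ measurable_fun `[0, s] (fun t => complex.Re (u t)),
      measurable_fun `[0, s] (fun t => complex.Im (u t)) &
      (\int[mu]_(t in `[0%R, s]) ((rnorm (u t : C^o)) ^+ 2)%:E < +oo)%E].

Definition in_L2loc (u : R -> C) := forall s : R, 0 <= s -> in_L2 s u.

Definition cintegral (D : set R) (f : R -> C) : C :=
  Complex (\int[mu]_(t in D) complex.Re (f t))
          (\int[mu]_(t in D) complex.Im (f t)).

Definition L2dot (s : R) (f g : R -> C) : C :=
  cintegral `[0, s] (fun t => f t * Num.conj (g t)).

Definition L2norm (s : R) (f : R -> C) : R :=
  Num.sqrt (complex.Re (L2dot s f f)).

Definition lspan (B : set (R -> C)) : set (R -> C) :=
  [set g | exists n (a : 'I_n -> C) (f : 'I_n -> R -> C),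
     (forall i, B (f i)) /\ g = (fun t => \sum_(i < n) a i * f i t)].

Definition L2closure (s : R) (B : set (R -> C)) : set (R -> C) :=
  [set f | forall eps : R, 0 < eps ->
     exists2 g, B g & L2norm s (fun t => f t - g t) < eps].

Definition L2minimal (s : R) (x : nat -> R -> C) :=
  forall j, ~ L2closure s (lspan [set x k | k in [set k | k != j]]) (x j).

Definition gram (s : R) (x : nat -> R -> C) (n : nat) : 'M[C]_n :=
  \matrix_(i < n, j < n) L2dot s (x i) (x j).

(* Gram matrices are Hermitian; the order of C restricts to that of R on their
   (real) eigenvalues.                                                        *)
Definition is_min_eigenvalue (n : nat) (M : 'M[C]_n) (g : R) :=
  eigenvalue M (real_complex R g) /\
  forall a, eigenvalue M a -> real_complex R g <= a.

(* Shifted by one: the empty Gram matrix has no eigenvalue.                   *)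
Definition L2strongly_minimal (s : R) (x : nat -> R -> C) :=
  exists2 gam : nat -> R,
    forall n, is_min_eigenvalue (gram s x n.+1) (gam n) &
    exists2 l : R, 0 < l & gam n @[n --> \oo] --> l.

End L2.

Section control.
Context {R : realType}.
Local Notation C := R[i].
Local Notation mu := (@lebesgue_measure R).
Context {X V : hilbertType R}.
(* SV extends the semigroup S of X to V. *)
Variables (S : R -> X -> X) (iV : X -> V) (SV : R -> V -> V) (b : V).

Definition is_control_integral (u : R -> C) (t : R) (v : V) :=
  is_bochner_integral `[0, t] (fun tau => SV (t - tau) (u tau *: b)) v.

Definition admissible := forall (u : R -> C) (t : R), in_L2loc u -> 0 <= t ->
  exists x, is_control_integral u t (iV x).

(* x is the value at time t of the mild solution of x' = Ax + bu, x(0) = x0.  *)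
Definition is_mild_solution (x0 : X) (u : R -> C) (t : R) (x : X) :=
  exists2 v, is_control_integral u t v & iV x = iV (S t x0) + v.

Definition null_controllable (t1 t2 : R) :=
  forall x0 : X, exists u : R -> C,
    [/\ in_L2 t2 u,
        {ae mu, forall t, t2 <= t -> u t = 0} &
        is_mild_solution x0 u t1 0].

End control.

(* Main.v *)
Require Import Defs.
From HB Require Import structures.
From mathcomp Require Import all_boot all_order all_algebra.
From mathcomp Require Import all_classical all_reals all_analysis.
From mathcomp Require Import measurable_realfun.
From mathcomp Require Import complex.
From mathcomp Require Import ring lra.

Set Implicit Arguments.
Unset Strict Implicit.
Unset Printing Implicit Defensive.

Import Order.TTheory GRing.Theory Num.Theory.
Import numFieldNormedType.Exports.

Local Open Scope classical_set_scope.
Local Open Scope ring_scope.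

(** The functionals [v |-> (v, psi_j)] diagonalize the dynamics: along the
    semigroup they are multiplied by [exp (lam_j t)] ([eigenfunctional_semigroup]
    on [X], [pair_extended_semigroup] on [V]).  Applied to the Bochner integral
    of the mild solution they turn a control [u] supported in [0, s], where
    [s = t1 - T], into its moments: at a time [t >= s] the j-th component of the
    state is [exp (lam_j t) * ((x0, psi_j) + \int_0^s F_j u)]
    ([control_moment]).

    Necessity.  A control steering [phi_j] to zero has moments 0 against the
    [F_k] with [k != j], and -1 against [F_j].  Hence [F] has a biorthogonal
    family in L2, and a sequence with a biorthogonal family is minimal
    ([biorthogonal_minimal]).

    Sufficiency.  Strong minimality says that the Gram matrices are bounded below
    by a positive constant, that is, [gam * \sum |c_i|^2 <= |\sum c_i F_i|^2] for
    all finite families ([gram_riesz]).  Under this bound every square summable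
    sequence is the moment sequence of some function of L2 ([moment_problem]),
    obtained as the limit of the solutions of the truncated problems; here
    completeness of L2 is needed ([L2_complete]).  For the moments
    [- (x0, psi_j)] this yields a control after which the state [z] at time [s]
    is annihilated by all the [psi_j].  For [r > 0] the vector [S (T + r) z] is
    the sum of a series of eigenvectors whose coefficients are its products with
    the [psi_j], all zero; so [S (T + r) z = 0], and [r -> 0] gives [S T z = 0],
    which is the state at time [t1] since the control vanishes after [s].

    The spectral relation for the functionals rests on the resolvent, which
    reduces it to vectors of the domain of the generator, and on the local
    boundedness of the semigroup ([c0_locally_bounded]), which comes from the
    uniform boundedness principle ([uniform_boundedness]). *)

(** * Complex numbers and real-valued norms *)

Section complex_numbers.
Context {R : realType}.
Local Notation C := R[i].
Implicit Types (z w : C) (x : R).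

Definition cabs z : R := complex.Re `|z|.

Lemma normcE_cabs z : `|z| = real_complex R (cabs z).
Proof. by rewrite /cabs normc_def. Qed.

Lemma cabs_sqr z : cabs z ^+ 2 = complex.Re z ^+ 2 + complex.Im z ^+ 2.
Proof.
by rewrite /cabs normc_def /= sqr_sqrtr// addr_ge0 ?sqr_ge0.
Qed.

Lemma cabs_ge0 z : 0 <= cabs z.
Proof. by rewrite /cabs normc_def /= sqrtr_ge0. Qed.

Lemma cabsM z w : cabs (z * w) = cabs z * cabs w.
Proof. by apply: complexI; rewrite rmorphM /= -!normcE_cabs normrM. Qed.

Lemma cabsD z w : cabs (z + w) <= cabs z + cabs w.
Proof. by rewrite -lecR rmorphD /= -!normcE_cabs ler_normD. Qed.

Lemma cabsN z : cabs (- z) = cabs z.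
Proof. by rewrite /cabs normrN. Qed.

Lemma cabs0 : cabs 0 = 0.
Proof. by rewrite /cabs normr0. Qed.

Lemma cabs_eq0 z : cabs z = 0 -> z = 0.
Proof. by move=> z0; apply/eqP; rewrite -normr_eq0 normcE_cabs z0. Qed.

Lemma cabs_gt0 z : z != 0 -> 0 < cabs z.
Proof.
move=> z0; rewrite lt_neqAle cabs_ge0 andbT eq_sym.
by apply: contra z0 => /eqP/cabs_eq0 ->.
Qed.

Lemma cabs_real x : cabs (real_complex R x) = `|x|.
Proof. by rewrite /cabs normc_def /= expr0n addr0 sqrtr_sqr. Qed.

Lemma cabs_conj z : cabs (Num.conj z) = cabs z.
Proof. by rewrite /cabs norm_conjC. Qed.

Lemma cabs_geRe z : `|complex.Re z| <= cabs z.
Proof.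
by rewrite -(@ler_pXn2r _ 2)// ?nnegrE ?cabs_ge0// cabs_sqr real_normK ?num_real//
  lerDl sqr_ge0.
Qed.

Lemma cabs_geIm z : `|complex.Im z| <= cabs z.
Proof.
by rewrite -(@ler_pXn2r _ 2)// ?nnegrE ?cabs_ge0// cabs_sqr real_normK ?num_real//
  lerDr sqr_ge0.
Qed.

Lemma cabs_leReIm z : cabs z <= `|complex.Re z| + `|complex.Im z|.
Proof.
rewrite -(@ler_pXn2r _ 2)// ?nnegrE ?cabs_ge0 ?addr_ge0// cabs_sqr.
rewrite sqrrD !real_normK ?num_real// -addrA [_ *+ 2 + _]addrC addrA lerDl.
by rewrite mulrn_wge0 ?mulr_ge0.
Qed.

Lemma mulr_conjE z : z * Num.conj z = real_complex R (cabs z ^+ 2).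
Proof. by rewrite rmorphXn /= -normcE_cabs -normCK. Qed.

Lemma cReM z w : complex.Re (z * w) =
  complex.Re z * complex.Re w - complex.Im z * complex.Im w.
Proof. by case: z w => [a b] [c d]. Qed.

Lemma cImM z w : complex.Im (z * w) =
  complex.Re z * complex.Im w + complex.Im z * complex.Re w.
Proof. by case: z w => [a b] [c d]. Qed.

Lemma cReD z w : complex.Re (z + w) = complex.Re z + complex.Re w.
Proof. by case: z w => [a b] [c d]. Qed.

Lemma cImD z w : complex.Im (z + w) = complex.Im z + complex.Im w.
Proof. by case: z w => [a b] [c d]. Qed.

Lemma cReN z : complex.Re (- z) = - complex.Re z.
Proof. by case: z => [a b]. Qed.

Lemma cImN z : complex.Im (- z) = - complex.Im z.
Proof. by case: z => [a b]. Qed.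

Lemma conjE z : Num.conj z = Complex (complex.Re z) (- complex.Im z).
Proof. by case: z. Qed.

Lemma cplx_eq z w : complex.Re z = complex.Re w -> complex.Im z = complex.Im w ->
  z = w.
Proof. by case: z w => [a b] [c d] /= -> ->. Qed.

Lemma cexpD z w : cexp (z + w) = cexp z * cexp w.
Proof.
apply: cplx_eq; rewrite ?cReM ?cImM /= cReD cImD expRD ?cosD ?sinD; ring.
Qed.

Lemma cexp0 : cexp 0 = 1 :> C.
Proof. by rewrite /cexp /= cos0 sin0 expR0 mulr1 mulr0. Qed.

Lemma cexpX z n : cexp (z *+ n) = cexp z ^+ n.
Proof.
by elim: n => [|n IH]; rewrite ?mulr0n ?cexp0 ?expr0// mulrS exprS cexpD IH.
Qed.

Lemma cabs_cexp z : cabs (cexp z) = expR (complex.Re z).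
Proof.
apply/eqP; rewrite -(@eqrXn2 _ 2)// ?cabs_ge0 ?expR_ge0//; apply/eqP.
rewrite cabs_sqr /= !exprMn -mulrDr cos2Dsin2 mulr1//.
Qed.

Lemma cexp_neq0 z : cexp z != 0.
Proof.
apply/eqP => e0; have := cabs_cexp z; rewrite e0 cabs0 => /esym/eqP.
by rewrite gt_eqF// expR_gt0.
Qed.

(** Both real components are products of an exponential and a trigonometric
    function, with derivatives [Re z] and [Im z] at 0. *)
Lemma cexp_sub_linear z (e : R) : 0 < e ->
  exists2 d : R, 0 < d & forall h, 0 < h -> h < d ->
    cabs (cexp (z * real_complex R h) - 1 - z * real_complex R h) <= e * h.
Proof.
move=> e0.
pose a := complex.Re z; pose b := complex.Im z.
pose fr (h : R) := expR (a * h) * cos (b * h).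
pose fi (h : R) := expR (a * h) * sin (b * h).
have scaleE (x y : R) : x *: (y : R^o) = x * y by [].
have dr : is_derive (0 : R) (1 : R) fr a.
  apply: is_derive_eq; rewrite !mulr0 expR0 cos0 sin0 !scaleE; ring.
have di : is_derive (0 : R) (1 : R) fi b.
  apply: is_derive_eq; rewrite !mulr0 expR0 cos0 sin0 !scaleE; ring.
have key (f : R -> R) (c : R) : is_derive (0 : R) (1 : R) f c ->
    exists2 d : R, 0 < d & forall h, 0 < h -> h < d ->
    `|f h - f 0 - c * h| <= e / 2 * h.
  move=> [/cvg_ex[l fl] fc].
  have {fc} lc : l = c by rewrite -fc; apply/esym/cvg_lim.
  rewrite {}lc in fl.
  have e20 : 0 < e / 2 by rewrite divr_gt0.
  have := (cvgrPdist_lt _ _).1 fl (e / 2) e20.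
  move=> /(_ _)/nbhs_ballP[d /= d0 dP]; exists d => // h h0 hd.
  have /dP/(_ _) : ball (0 : R) d h by rewrite /ball/= sub0r normrN gtr0_norm.
  move=> /(_ (lt0r_neq0 h0)) /ltW; rewrite /= addr0 !scaleE mulr1 => H.
  have -> : f h - f 0 - c * h = - ((c - h^-1 * (f h - f 0)) * h).
    by field; rewrite lt0r_neq0.
  by rewrite normrN normrM (gtr0_norm h0) ler_wpM2r// ltW.
have [d1 d10 H1] := key _ _ dr.
have [d2 d20 H2] := key _ _ di.
exists (Num.min d1 d2); first by rewrite lt_min d10.
move=> h h0; rewrite lt_min => /andP[h1 h2].
have := cabs_leReIm (cexp (z * real_complex R h) - 1 - z * real_complex R h).
move=> /le_trans; apply.
have := lerD (H1 h h0 h1) (H2 h h0 h2).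
rewrite -mulrDl -splitr; apply: le_trans.
rewrite !cReD !cImD !cReN !cImN cReM cImM /= !mulr0 subr0 add0r cReM cImM /=.
rewrite /fr /fi !mulr0 expR0 cos0 sin0 /a /b.
by rewrite !(mulr1, mulr0, subr0, add0r, addr0, oppr0).
Qed.

End complex_numbers.


Section real_norm.
Context {R : realType}.
Local Notation C := R[i].

Lemma normrE_rnorm (V : normedModType C) (v : V) :
  `|v| = real_complex R (rnorm v).
Proof. by rewrite /rnorm; apply/esym/RRe_real; rewrite ger0_real. Qed.

Lemma rnorm_ge0 (V : normedModType C) (v : V) : 0 <= rnorm v.
Proof. by rewrite -lecR -normrE_rnorm normr_ge0. Qed.

Lemma rnormD (V : normedModType C) (v w : V) : rnorm (v + w) <= rnorm v + rnorm w.
Proof. by rewrite -lecR rmorphD /= -!normrE_rnorm ler_normD. Qed.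

Lemma rnormN (V : normedModType C) (v : V) : rnorm (- v) = rnorm v.
Proof. by rewrite /rnorm normrN. Qed.

Lemma rnormB (V : normedModType C) (v w : V) : rnorm (v - w) = rnorm (w - v).
Proof. by rewrite -rnormN opprB. Qed.

Lemma rnormZ (V : normedModType C) (a : C) (v : V) :
  rnorm (a *: v) = cabs a * rnorm v.
Proof. by apply: complexI; rewrite rmorphM /= -!normrE_rnorm -normcE_cabs normrZ. Qed.

Lemma rnorm0 (V : normedModType C) : rnorm (0 : V) = 0.
Proof. by rewrite /rnorm normr0. Qed.

Lemma rnorm_eq0 (V : normedModType C) (v : V) : rnorm v = 0 -> v = 0.
Proof. by move=> v0; apply/eqP; rewrite -normr_eq0 normrE_rnorm v0. Qed.

Lemma rnorm_cabs (z : C) : rnorm (z : C^o) = cabs z.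
Proof. by []. Qed.

(** Real tolerances suffice: the positive elements of R[i] are the positive
    reals. *)
Lemma cvg_rnormP (V : normedModType C) T (F : set_system T) {FF : Filter F}
    (f : T -> V) (l : V) :
  f x @[x --> F] --> l <->
  forall e : R, 0 < e -> \forall x \near F, rnorm (f x - l) < e.
Proof.
split=> [/cvgrPdist_lt fl e e0|fl]; last apply/cvgrPdist_lt => e e0.
  have /fl : 0 < real_complex R e by rewrite ltcR.
  by apply: filterS => x; rewrite normrE_rnorm ltcR rnormB.
have eE : e = real_complex R (complex.Re e) by rewrite RRe_real// gtr0_real.
have /fl : 0 < complex.Re e by rewrite -ltcR -eE.
by apply: filterS => x fx; rewrite normrE_rnorm [X in _ < X]eE ltcR rnormB.
Qed.

Lemma cvg_unique_rnorm (V : normedModType C) T (F : set_system T)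
    {FF : ProperFilter F} (f : T -> V) (l l' : V) :
  f x @[x --> F] --> l -> f x @[x --> F] --> l' -> l = l'.
Proof. by move=> fl fl'; apply: cvg_unique fl fl'; exact: norm_hausdorff. Qed.

Lemma rnorm_le_eps (V : normedModType C) (v : V) :
  (forall e : R, 0 < e -> rnorm v <= e) -> v = 0.
Proof.
move=> H; apply: rnorm_eq0; apply/eqP; rewrite eq_le rnorm_ge0 andbT.
by apply/ler_addgt0Pl => e e0; rewrite addr0 H.
Qed.

Lemma bounded_linear_bound (E F : normedModType C) (f : E -> F) :
  bounded_linear f -> exists2 K : R, 0 < K & forall x, rnorm (f x) <= K * rnorm x.
Proof.
move=> [lf cf].
pose g : {linear E -> F} := HB.pack f (GRing.isLinear.Build _ _ _ _ _ lf).
have /linear_boundedP[M [Mr HM]] : bounded_near g (nbhs 0).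
  by apply: continuous_linear_bounded => x; exact: cf.
pose K := `|complex.Re M| + 1.
have K0 : 0 < K by rewrite ltr_wpDl.
exists K => // x; rewrite -lecR rmorphM /= -!normrE_rnorm.
apply: HM; rewrite -[M]RRe_real// ltcR /K.
by rewrite (le_lt_trans (ler_norm _))// ltrDl.
Qed.

Section bounded_linear_theory.
Variables (E F : normedModType C) (f : E -> F).
Hypothesis bf : bounded_linear f.

Let g : {linear E -> F} := HB.pack f (GRing.isLinear.Build _ _ _ _ _ bf.1).

Lemma blinD x y : f (x + y) = f x + f y. Proof. exact: (linearD g). Qed.
Lemma blinB x y : f (x - y) = f x - f y. Proof. exact: (linearB g). Qed.
Lemma blinZ a x : f (a *: x) = a *: f x. Proof. exact: (linearZZ g). Qed.
Lemma blin0 : f 0 = 0. Proof. exact: (linear0 g). Qed.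
Lemma blin_sum I (r : seq I) (P : pred I) h :
  f (\sum_(i <- r | P i) h i) = \sum_(i <- r | P i) f (h i).
Proof. exact: (linear_sum g). Qed.

Lemma blin_cvg T (G : set_system T) {FG : Filter G} (h : T -> E) l :
  h x @[x --> G] --> l -> f (h x) @[x --> G] --> f l.
Proof. by move=> hl; apply: (cvg_comp _ _ hl); exact: bf.2. Qed.

End bounded_linear_theory.

Lemma bounded_linearI (E F : normedModType C) (f : E -> F) (K : R) :
  linear f -> (forall x, rnorm (f x) <= K * rnorm x) -> bounded_linear f.
Proof.
move=> lf fK; split=> // x; apply/cvg_rnormP => e e0.
pose g : {linear E -> F} := HB.pack f (GRing.isLinear.Build _ _ _ _ _ lf).
have K1 : 0 < `|K| + 1 by rewrite ltr_wpDl.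
have := (cvg_rnormP (F := nbhs x) id x).1 cvg_id (e / (`|K| + 1)).
rewrite divr_gt0// => /(_ _ isT); apply: filterS => y yx.
rewrite -[f y - f x](linearB g); apply: le_lt_trans (fK _) _.
rewrite (@le_lt_trans _ _ ((`|K| + 1) * rnorm (y - x)))//.
  by rewrite ler_wpM2r ?rnorm_ge0// (le_trans (ler_norm _))// lerDl.
by rewrite mulrC -ltr_pdivlMr.
Qed.

End real_norm.

(** * Local boundedness of semigroups *)

Section uniform_boundedness.
Context {R : realType}.
Local Notation C := R[i].

Lemma cauchy_rnorm_cvg (E : completeNormedModType C) (x : nat -> E) (r : nat -> R) :
  r n @[n --> \oo] --> 0 ->
  (forall k m, (k <= m)%N -> rnorm (x m - x k) <= r k) ->
  exists l, forall k, rnorm (l - x k) <= r k.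
Proof.
move=> r0 xr.
have xc : cauchy (x n @[n --> \oo]).
  apply: cauchy_exP => e e0.
  have eE : e = real_complex R (complex.Re e) by rewrite RRe_real// gtr0_real.
  have e1 : 0 < complex.Re e by rewrite -ltcR -eE.
  have /cvgrPdist_lt/(_ _ e1)[N _ HN] := r0.
  exists (x N); exists N => // m /= Nm.
  rewrite -ball_normE /= normrE_rnorm [X in _ < X]eE ltcR rnormB.
  apply: le_lt_trans (xr _ _ Nm) _.
  have := HN N (leqnn N); rewrite /= sub0r normrN; apply: le_lt_trans.
  exact: ler_norm.
have /cvg_ex[l xl] : cvg (x n @[n --> \oo]) by exact: cauchy_cvg.
exists l => k; apply/ler_addgt0Pl => e e0.
have [N _ HN] := (cvg_rnormP _ _).1 xl _ e0.
have := HN (maxn N k) (leq_maxl _ _) => /= H.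
rewrite -[l - x k](@subrKA _ (x (maxn N k))).
apply: le_trans (rnormD _ _) _; rewrite addrC.
by rewrite addrC lerD ?xr ?leq_maxr// rnormB ltW.
Qed.

(** A gliding hump: when the family is not equibounded, every ball contains a
    smaller closed one on which some [T n] exceeds any prescribed value, and
    the common point of nested such balls contradicts pointwise boundedness. *)
Theorem uniform_boundedness (E : completeNormedModType C) (F : normedModType C)
    (T : nat -> E -> F) :
  (forall n, bounded_linear (T n)) ->
  (forall x, exists M : R, forall n, rnorm (T n x) <= M) ->
  exists M : R, forall n x, rnorm (T n x) <= M * rnorm x.
Proof.
move=> bT pT; apply: contrapT => nM.
have large (M : R) : exists n x, M * rnorm x < rnorm (T n x).
  apply: contrapT => H; apply: nM; exists M => n x; rewrite leNgt.
  by apply/negP => Hx; apply: H; exists n, x.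
have hump (k : nat) (p : E * R) : exists q : E * R, 0 < p.2 ->
    [/\ 0 < q.2, q.2 <= p.2 / 2, rnorm (q.1 - p.1) <= p.2 / 2 &
     exists n, forall z, rnorm (z - q.1) <= q.2 -> k%:R <= rnorm (T n z)].
  have [r0|] := boolP (0 < p.2); last by exists p.
  have r20 : 0 < p.2 / 2 by rewrite divr_gt0.
  have [n [y ny]] := large ((k.+1)%:R / (p.2 / 2)).
  have y0 : 0 < rnorm y.
    rewrite lt_neqAle rnorm_ge0 andbT; apply/negP => /eqP/esym/rnorm_eq0 y0.
    by move: ny; rewrite y0 (blin0 (bT n)) !rnorm0 mulr0 ltxx.
  pose c := real_complex R (p.2 / 2 / rnorm y).
  have cy : rnorm (c *: y) = p.2 / 2.
    by rewrite rnormZ cabs_real gtr0_norm ?divr_gt0// mulfVK ?gt_eqF.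
  have Tcy : k.+1%:R <= rnorm (T n (c *: y)).
    rewrite (blinZ (bT n)) rnormZ cabs_real gtr0_norm ?divr_gt0//.
    have c0 : 0 < p.2 / 2 / rnorm y by rewrite divr_gt0.
    rewrite -ler_pdivrMl// ltW// (le_lt_trans _ ny)// le_eqVlt; apply/orP; left.
    by apply/eqP; field; rewrite !lt0r_neq0.
  (* [T n (c *: y)] is half the difference of the images of [p.1 + c *: y] and
     [p.1 - c *: y], so one of these images is at least as large. *)
  have [x' x'p Tx'] : exists2 x', rnorm (x' - p.1) <= p.2 / 2 &
      k.+1%:R <= rnorm (T n x').
    have [H|H] := leP k.+1%:R (rnorm (T n (p.1 + c *: y))).
      by exists (p.1 + c *: y) => //; rewrite addrC addKr cy.
    exists (p.1 - c *: y); first by rewrite addrAC subrr sub0r rnormN cy.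
    rewrite leNgt; apply/negP => H'.
    have := rnormD (T n (p.1 + c *: y)) (- T n (p.1 - c *: y)).
    rewrite -(blinB (bT n)) rnormN opprB addrA [p.1 + _]addrC addrAC addrK.
    rewrite (blinD (bT n)) -mulr2n -scaler_nat rnormZ.
    rewrite -[2%:R](rmorph_nat (real_complex R)) cabs_real ger0_norm//.
    by rewrite [c *: y + _]addrC => H2; move: H H' Tcy H2; rewrite -natr1; lra.
  have [K K0 TK] := bounded_linear_bound (bT n).
  exists (x', Num.min (p.2 / 2) K^-1) => _; split => /=.
  - by rewrite lt_min r20 invr_gt0.
  - by rewrite ge_min lexx.
  - by [].
  - exists n => z; rewrite le_min => /andP[_ zK].
    have Tz : rnorm (T n (z - x')) <= 1.
      by apply: le_trans (TK _) _; rewrite -(divff (lt0r_neq0 K0)) ler_pM2l.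
    have := rnormD (T n z) (- T n (z - x')).
    rewrite -(blinB (bT n)) opprB addrC subrK rnormN => /(le_trans Tx').
    by move: Tz; rewrite -natr1 => Tz H; lra.
have [G HG] := choice (fun kp : nat * (E * R) => hump kp.1 kp.2).
pose st := fix st k := if k is k'.+1 then G (k', st k') else (0 : E, 1 : R).
have st0 k : 0 < (st k).2.
  by elim: k => [|k IH] //=; have [] := HG (k, st k) IH.
have st2 k : (st k).2 <= 2^-1 ^+ k.
  elim: k => [|k IH]; first by rewrite expr0.
  have [_ H _ _] := HG (k, st k) (st0 k).
  by rewrite (le_trans H)// exprS mulrC ler_wpM2l ?invr_ge0.
have near k m : (k <= m)%N -> rnorm ((st m).1 - (st k).1) + (st m).2 <= (st k).2.
  elim: m => [|m IH]; first by rewrite leqn0 => /eqP ->; rewrite subrr rnorm0 add0r.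
  rewrite leq_eqVlt => /orP[/eqP ->|/IH {}IH].
    by rewrite subrr rnorm0 add0r.
  have [_ H1 H2 _] := HG (m, st m) (st0 m).
  apply: le_trans IH; rewrite [X in _ <= _ + X]splitr addrA lerD//.
  rewrite -(@subrKA _ (st m).1).
  by apply: le_trans (rnormD _ _) _; rewrite addrC lerD.
have [] := @cauchy_rnorm_cvg E (fun k => (st k).1) (fun k => (st k).2).
- apply: (@squeeze_cvgr _ _ _ _ (cst 0) (fun n => 2^-1 ^+ n)).
  + by apply: nearW => n; rewrite ltW ?st0 ?st2.
  + exact: cvg_cst.
  + by apply: cvg_expr; rewrite ger0_norm ?invf_lt1// ltr1n.
- by move=> k m km; rewrite (le_trans _ (near _ _ km))// lerDl ltW.
move=> l Hl; have [M HM] := pT l.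
pose k := (Num.truncn M).+1.
have [_ _ _ [n Hn]] := HG (k, st k) (st0 k).
have := Hn l (Hl k.+1) => /= /le_trans/(_ (HM n)).
by rewrite leNgt truncnS_gt.
Qed.

End uniform_boundedness.

Section semigroups.
Context {R : realType}.
Local Notation C := R[i].

(** Otherwise there are times tending to 0 at which the operators exceed every
    bound, although continuity at 0 bounds each of their orbits. *)
Lemma c0_bounded_near0 (E : completeNormedModType C) (S : R -> E -> E) :
  c0_semigroup S -> exists d M : R, [/\ 0 < d, 1 <= M &
    forall t x, 0 <= t -> t <= d -> rnorm (S t x) <= M * rnorm x].
Proof.
move=> HS; apply: contrapT => H.
have bad (n : nat) : exists p : R * E,
    [/\ 0 <= p.1, p.1 <= n.+1%:R^-1 & n.+1%:R * rnorm p.2 < rnorm (S p.1 p.2)].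
  apply: contrapT => Hn; apply: H; exists n.+1%:R^-1, n.+1%:R; split=> //.
    by rewrite ler1n.
  move=> t x t0 tn; rewrite leNgt; apply/negP => Hx.
  by apply: Hn; exists (t, x).
have {bad} [p Hp] := choice bad.
have [|M HM] := uniform_boundedness (T := fun n => S (p n).1)
  (fun n => c0_bounded HS (let: And3 h _ _ := Hp n in h)).
  move=> x; have /cvg_rnormP/(_ 1 ltr01) := c0_cont HS (x := x).
  move=> [d /= d0 Hd].
  have [N _ HN] : \forall n \near \oo, (n.+1%:R^-1 : R) < d.
    exists (Num.truncn d^-1) => // n /= dn.
    rewrite invf_plt ?posrE//; apply: lt_le_trans (truncnS_gt _) _.
    by rewrite ler_nat.
  exists (rnorm x + 1 + \sum_(n < N) rnorm (S (p n).1 x)) => n.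
  have s0 : 0 <= \sum_(n < N) rnorm (S (p n).1 x) by apply: sumr_ge0 => i _; apply: rnorm_ge0.
  have [nN|Nn] := ltnP n N.
    rewrite (bigD1 (Ordinal nN)) //= [_ + (rnorm (S (p n).1 x) + _)]addrCA lerDl.
    by rewrite addr_ge0 ?addr_ge0 ?rnorm_ge0 ?sumr_ge0// => i _; apply: rnorm_ge0.
  have [t0 tn _] := Hp n.
  apply: ler_wpDr => //.
  move: t0; rewrite le_eqVlt => /orP[/eqP <-|t0].
    by rewrite (c0_id HS) lerDl.
  have := Hd (p n).1; rewrite /= sub0r normrN gtr0_norm// => /(_ (le_lt_trans tn (HN _ Nn)) t0).
  have := rnormD x (S (p n).1 x - x); rewrite addrC subrK => H1 /ltW H2.
  by rewrite (le_trans H1)// lerD2l.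
have [_ _] := Hp (Num.truncn M).
apply/negP; rewrite -leNgt; apply: le_trans (HM _ _) _.
by rewrite ler_wpM2r ?rnorm_ge0// ltW// truncnS_gt.
Qed.

Lemma c0_locally_bounded (E : completeNormedModType C) (S : R -> E -> E) (t1 : R) :
  c0_semigroup S -> exists M : R, [/\ 0 < M &
    forall t x, 0 <= t -> t <= t1 -> rnorm (S t x) <= M * rnorm x].
Proof.
move=> HS; have [d [M [d0 M1 HM]]] := c0_bounded_near0 HS.
have pow n : forall t x, 0 <= t -> t <= n%:R * d -> rnorm (S t x) <= M ^+ n * rnorm x.
  elim: n => [|n IH] t x t0.
    rewrite mul0r => t0'; have -> : t = 0 by apply/eqP; rewrite eq_le t0 t0'.
    by rewrite (c0_id HS) mul1r.
  move=> tn; have [td|/ltW dt] := leP t d.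
    rewrite (le_trans (HM _ _ t0 td))// ler_wpM2r ?rnorm_ge0//.
    by rewrite exprS ler_peMr ?exprn_ege1// (le_trans ler01).
  have -> : t = d + (t - d) by rewrite addrC subrK.
  have td0 : 0 <= t - d by rewrite subr_ge0.
  rewrite (c0_add HS _ (ltW d0) td0) exprS -mulrA.
  apply: le_trans (HM _ _ (ltW d0) (lexx d)) _.
  rewrite ler_wpM2l ?(le_trans ler01)// IH// lerBlDr.
  by move: tn; rewrite -natr1 mulrDl mul1r.
pose n := (Num.truncn (t1 / d)).+1.
exists (M ^+ n); split; first by rewrite exprn_gt0// (lt_le_trans ltr01).
move=> t x t0 tt1; apply: pow => //; apply: le_trans tt1 _.
by rewrite -ler_pdivrMr// ltW// truncnS_gt.
Qed.

(** * Eigenfunctionals of a generator *)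

Section eigenfunctional.
Variables (E : completeNormedModType C) (S : R -> E -> E) (L : E -> C^o) (lam : C).
Hypothesis HS : c0_semigroup S.
Hypothesis bL : bounded_linear L.
Hypothesis L_eigen : forall x y, generator S x y -> L y = lam * L x.

Lemma generator_semigroup t x y : 0 <= t ->
  generator S x y -> generator S (S t x) (S t y).
Proof.
move=> t0 /(blin_cvg (c0_bounded HS t0)); rewrite /generator.
apply: cvg_trans; apply: near_eq_cvg; near=> h.
have h0 : 0 <= h by near: h; exact: nbhs_right_ge.
rewrite (blinZ (c0_bounded HS t0)) (blinB (c0_bounded HS t0)).
by rewrite -(c0_add HS _ t0 h0) -(c0_add HS _ h0 t0) [t + h]addrC.
Unshelve. all: by end_near.
Qed.

(** Over a short time [h], [L (S h x)] differs from [cexp (lam * h) * L x] by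
    [o(h)], uniformly on the orbit of a point of the domain because the
    semigroup is locally bounded; adding up the [t / h] errors made along the
    orbit leaves [o(1)]. *)
Lemma eigenfunctional_generator t x y : 0 <= t -> generator S x y ->
  L (S t x) = cexp (lam * real_complex R t) * L x.
Proof.
rewrite le_eqVlt => /orP[/eqP <- _|t0 xy].
  by rewrite (c0_id HS) mulr0 cexp0 mul1r.
have [M [M0 HM]] := c0_locally_bounded t HS.
have [K K0 LK] := bounded_linear_bound bL.
apply/eqP; rewrite -subr_eq0; apply/eqP.
set m := expR `|complex.Re lam * t|.
have m0 : 0 < m by exact: expR_gt0.
(* [B * e'] will bound the sum of all the one-step errors. *)
pose B := m * (t * (K * M + K * (M * rnorm x))).
have [M_ge0 K_ge0] := (ltW M0, ltW K0).
have B0 : 0 <= B.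
  by rewrite /B mulr_ge0 ?(ltW m0)// mulr_ge0 ?(ltW t0)// addr_ge0 ?mulr_ge0 ?rnorm_ge0.
apply: (@rnorm_le_eps _ C^o) => e e0.
pose e' := e / (B + 1).
have e'0 : 0 < e' by rewrite divr_gt0// ltr_wpDl.
have [d1 d10 Hd1] := cexp_sub_linear lam e'0.
have [d2 /= d20 Hd2] := (cvg_rnormP _ _).1 xy _ e'0.
have [n nt] : exists n : nat, t / n.+1%:R < Num.min d1 d2.
  have dd0 : 0 < Num.min d1 d2 by rewrite lt_min d10.
  exists (Num.truncn (t / Num.min d1 d2)).
  by rewrite ltr_pdivrMr// [X in _ < X]mulrC -ltr_pdivrMr// truncnS_gt.
move: nt; rewrite lt_min => /andP[hd1 hd2].
set h := t / n.+1%:R in hd1 hd2.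
have h0 : 0 < h by rewrite divr_gt0.
have nh : n.+1%:R * h = t by rewrite mulrC mulfVK// pnatr_eq0.
pose a := cexp (lam * real_complex R h).
pose g k := L (S (k%:R * h) x).
have khP k : (k <= n)%N -> 0 <= k%:R * h /\ k%:R * h <= t.
  by move=> kn; rewrite mulr_ge0 ?(ltW h0)//; split=> //; rewrite -nh ler_pM2r// ler_nat ltnW.
have inc k : (k <= n)%N -> cabs (g k.+1 - a * g k) <= e' * h * (K * M + K * (M * rnorm x)).
  move=> /khP[kh0 kht].
  pose r := S h x - x - real_complex R h *: y.
  have rh : rnorm r <= h * e'.
    have := Hd2 h; rewrite /= sub0r normrN gtr0_norm// => /(_ hd2 h0)/ltW H.
    have -> : r = real_complex R h *: (real_complex R h^-1 *: (S h x - x) - y).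
      by rewrite scalerBr scalerA -rmorphM /= divff ?lt0r_neq0// scale1r.
    by rewrite rnormZ cabs_real gtr0_norm// ler_pM2l.
  have Sk := c0_bounded HS kh0.
  have -> : g k.+1 - a * g k = L (S (k%:R * h) r)
      - (a - 1 - lam * real_complex R h) * g k.
    rewrite /r !(blinB Sk) (blinZ Sk) !(blinB bL) (blinZ bL).
    rewrite (L_eigen (generator_semigroup kh0 xy)).
    rewrite -(c0_add HS)//; last exact: ltW.
    have -> : k%:R * h + h = k.+1%:R * h by rewrite -natr1 mulrDl mul1r.
    rewrite -/(g k) -/(g k.+1) -[_ *: _]/(_ * _); ring.
  rewrite mulrDr (le_trans (cabsD _ _))// cabsN lerD//.
    rewrite (le_trans (LK _))// [X in _ <= X]mulrCA ler_pM2l//.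
    by rewrite (le_trans (HM _ _ _ _))// [X in _ <= X]mulrC ler_pM2l// mulrC.
  rewrite cabsM ler_pM ?cabs_ge0// ?Hd1//.
  by rewrite (le_trans (LK _))// ler_pM2l// HM.
have ma k : (k <= n)%N -> cabs a ^+ k <= m.
  move=> /khP[kh0 kht]; rewrite /a cabs_cexp -expRM_natl ler_expR.
  rewrite cReM /= mulr0 subr0 mulrCA (le_trans (ler_norm _))//.
  rewrite [X in X <= _]normrM [X in _ <= X]normrM.
  by rewrite ler_wpM2l// (ger0_norm kh0) (gtr0_norm t0).
set del := e' * h * _ in inc.
(* The power of [a] is carried along the induction: bounding it by [m] at every
   step would yield [m ^+ k]. *)
have tele k : forall j, (j + k <= n.+1)%N ->
    cabs a ^+ j * cabs (g k - a ^+ k * g 0%N) <= k%:R * (m * del).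
  elim: k => [|k IH] j jk; first by rewrite expr0 mul1r subrr cabs0 mulr0 mul0r.
  have -> : g k.+1 - a ^+ k.+1 * g 0%N =
      (g k.+1 - a * g k) + a * (g k - a ^+ k * g 0%N) by rewrite exprS; ring.
  rewrite addnS ltnS in jk.
  apply: le_trans (ler_wpM2l (exprn_ge0 _ (cabs_ge0 _)) (cabsD _ _)) _.
  rewrite -natr1 mulrDl mul1r mulrDr addrC lerD//.
    by rewrite cabsM [X in X <= _]mulrA -exprSr IH// addSn ltnS.
  apply: ler_pM; rewrite ?exprn_ge0 ?cabs_ge0//.
    by apply: ma; rewrite (leq_trans (leq_addr _ _) jk).
  by apply: inc; rewrite (leq_trans (leq_addl _ _) jk).
have := tele n.+1 0%N (leqnn _); rewrite expr0 mul1r /del /g nh mul0r (c0_id HS).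
have -> : a ^+ n.+1 = cexp (lam * real_complex R t).
  have -> : real_complex R t = real_complex R h *+ n.+1.
    by rewrite -nh mulr_natl (rmorphMn (real_complex R)).
  by rewrite /a -cexpX mulrnAr.
move=> /le_trans; apply.
have -> : n.+1%:R * (m * (e' * h * (K * M + K * (M * rnorm x)))) = B * e'.
  by rewrite /B -nh; ring.
by rewrite /e' mulrCA ger_pMr// ler_pdivrMr ?mul1r ?lerDl// ltr_wpDl.
Qed.

(** The resolvent [B] maps into the domain and commutes with the semigroup, and
    [L u = (z - lam) * L (B u)], so the formula passes from [B x] to [x]. *)
Lemma eigenfunctional_semigroup z t x : resolvent_set (generator S) z ->
  z != lam -> 0 <= t -> L (S t x) = cexp (lam * real_complex R t) * L x.
Proof.
move=> [B [bB BA AB]] zl t0.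
have LB u : L u = (z - lam) * L (B u).
  have := L_eigen (AB u); rewrite (blinB bL) (blinZ bL) -[_ *: _]/(_ * _) => H.
  rewrite mulrBl -H; ring.
have BS : B (S t x) = S t (B x).
  have St := c0_bounded HS t0.
  rewrite -(BA _ _ (generator_semigroup t0 (AB x))); congr B.
  by rewrite -(blinZ St) -(blinB St) opprB addrC subrK.
rewrite LB BS (eigenfunctional_generator t0 (AB x)) [in RHS]LB; ring.
Qed.

End eigenfunctional.
End semigroups.

(** * Integration of complex functions and Bochner integrals *)

Import HBNNSimple.

(** The integral of a nonnegative function is the supremum over the simple
    functions below it, so this comparison is insensitive to measurability.  In
    a Bochner integral the integrand [x |-> rnorm (f x - step_fun (s n) x)] is
    not known to be measurable. *)
Lemma ge0_integral_dominated d (T : measurableType d) (R : realType)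
    (mu : {measure set T -> \bar R}) (D D' N : set T) (g1 g2 : T -> \bar R) (K : R) :
  0 < K -> mu.-negligible N ->
  (forall x, D x -> (0 <= g1 x)%E) -> (forall x, D' x -> (0 <= g2 x)%E) ->
  (forall x, D x -> ~ N x -> g1 x = 0%E \/ D' x /\ (g1 x <= K%:E * g2 x)%E) ->
  (\int[mu]_(x in D) g1 x <= K%:E * \int[mu]_(x in D') g2 x)%E.
Proof.
move=> K0 [N0 [mN0 muN0 NN0]] g10 g20 g12.
rewrite (ge0_integralE mu g10) (ge0_integralE mu g20) /=.
apply: ge_ereal_sup => _ [h /= hg <-].
have mC : measurable (~` N0) by exact: measurableC.
have Ki : 0 <= K^-1 by rewrite invr_ge0 ltW.
have [k kE] : exists k : {nnsfun T >-> R},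
    forall x, k x = K^-1 * (h x * \1_(~` N0) x).
  by exists (scale_nnsfun (mul_nnsfun h (indic_nnsfun R mC)) Ki).
have -> : sintegral mu h = (K%:E * sintegral mu k)%E.
  have mEh (q : {nnsfun T >-> R}) : measurable_fun setT (EFin \o q).
    by apply/measurable_EFinP; exact: measurable_funPT.
  have E (q : {nnsfun T >-> R}) : sintegral mu q = (\int[mu]_x (q x)%:E)%E.
    by rewrite integral_nnsfun// patch_setT.
  rewrite !E -ge0_integralZl//; last 3 first.
  - exact: mEh.
  - by move=> x _; rewrite lee_fin.
  - by rewrite lee_fin ltW.
  apply: ge0_ae_eq_integral => //.
  - exact: mEh.
  - by apply: measurable_funeM; exact: mEh.
  - by move=> x _; rewrite lee_fin.
  - by move=> x _; rewrite mule_ge0 ?lee_fin ?(ltW K0).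
  exists N0; split => // x /=; apply: contra_notP => xN _.
  by rewrite kE indicE mem_set// mulr1 -EFinM mulrA divff ?lt0r_neq0// mul1r.
rewrite lee_pmul2l//; apply: ereal_sup_ubound; exists k => // x /=.
rewrite kE; have [xN|xN] := pselect (N0 x).
  rewrite indicE memNset ?mulr0; last by move=> /(_ xN).
  by rewrite patchE; case: ifPn => // /set_mem/g20.
rewrite indicE mem_set// mulr1 EFinM.
have := hg x; rewrite !patchE.
have h0 : (0 <= (h x)%:E)%E by rewrite lee_fin.
have zero : ((h x)%:E <= 0)%E -> h x = 0.
  by move=> H; apply/eqP; rewrite eq_le -!lee_fin H h0.
case: ifPn => [/set_mem Dx|_ /zero ->]; last first.
  by rewrite mule0; case: ifPn => // /set_mem/g20.
have [->|[D'x g12x]] := g12 x Dx (fun Nx => xN (NN0 x Nx)).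
  by move=> /zero ->; rewrite mule0; case: ifPn => // /set_mem/g20.
by move=> /le_trans/(_ g12x) hK; rewrite mem_set// lee_pdivrMl.
Qed.

Section complex_integral.
Context {R : realType}.
Local Notation C := R[i].
Local Notation mu := (@lebesgue_measure R).
Implicit Types (D : set R) (f g : R -> C).

Definition cintegrable D f :=
  mu.-integrable D (EFin \o (fun x => complex.Re (f x))) /\
  mu.-integrable D (EFin \o (fun x => complex.Im (f x))).

Lemma eq_cintegral D f g : (forall x, D x -> f x = g x) ->
  cintegral D f = cintegral D g.
Proof.
move=> fg; rewrite /cintegral.
by congr Complex; apply: eq_Rintegral => x /set_mem/fg ->.
Qed.

Lemma eq_cintegrable D f g : @measurable _ (measurableTypeR R) D -> (forall x, D x -> f x = g x) ->
  cintegrable D f -> cintegrable D g.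
Proof.
move=> mD fg [f1 f2]; split.
  by apply: (eq_integrable mD _ _ _ f1) => x /set_mem/fg /= ->.
by apply: (eq_integrable mD _ _ _ f2) => x /set_mem/fg /= ->.
Qed.

Section closure.
Variables (D : set R) (mD : @measurable _ (measurableTypeR R) D).

Lemma cintegrableD f g : cintegrable D f -> cintegrable D g ->
  cintegrable D (fun x => f x + g x).
Proof.
move=> [f1 f2] [g1 g2]; split.
  by apply: (eq_integrable mD _ _ _ (integrableD mD f1 g1)) => x _ /=; rewrite cReD.
by apply: (eq_integrable mD _ _ _ (integrableD mD f2 g2)) => x _ /=; rewrite cImD.
Qed.

Lemma cintegrableZ a f : cintegrable D f -> cintegrable D (fun x => a * f x).
Proof.
move=> [f1 f2]; split.
  have H := integrableB mD (integrableZl mD (complex.Re a) f1)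
    (integrableZl mD (complex.Im a) f2).
  by apply: (eq_integrable mD _ _ _ H) => x _ /=; rewrite cReM.
have H := integrableD mD (integrableZl mD (complex.Re a) f2)
  (integrableZl mD (complex.Im a) f1).
by apply: (eq_integrable mD _ _ _ H) => x _ /=; rewrite cImM.
Qed.

Lemma cintegrable0 : cintegrable D (fun=> 0).
Proof. by split; exact: integrable0. Qed.

Lemma cintegrable_sum I (r : seq I) (P : pred I) (F : I -> R -> C) :
  (forall i, P i -> cintegrable D (F i)) ->
  cintegrable D (fun x => \sum_(i <- r | P i) F i x).
Proof.
move=> FI; elim: r => [|i r IH].
  by apply: (eq_cintegrable mD _ cintegrable0) => x _; rewrite big_nil.
have [Pi|Pi] := boolP (P i); last first.
  by apply: (eq_cintegrable mD _ IH) => x _; rewrite big_cons (negbTE Pi).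
by apply: (eq_cintegrable mD _ (cintegrableD (FI i Pi) IH)) => x _; rewrite big_cons Pi.
Qed.

Lemma cintegralD f g : cintegrable D f -> cintegrable D g ->
  cintegral D (fun x => f x + g x) = cintegral D f + cintegral D g.
Proof.
move=> [f1 f2] [g1 g2]; apply: cplx_eq; rewrite ?cReD ?cImD /=.
  by rewrite -RintegralD//; apply: eq_Rintegral => x _; rewrite cReD.
by rewrite -RintegralD//; apply: eq_Rintegral => x _; rewrite cImD.
Qed.

Lemma cintegralZ a f : cintegrable D f ->
  cintegral D (fun x => a * f x) = a * cintegral D f.
Proof.
move=> [f1 f2]; have Z c (h : R -> R) : mu.-integrable D (EFin \o h) ->
    mu.-integrable D (EFin \o (fun x => c * h x)).
  by move=> /(integrableZl mD c) H; apply: (eq_integrable mD _ _ _ H).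
apply: cplx_eq; rewrite ?cReM ?cImM /=.
  rewrite -!RintegralZl// -RintegralB ?Z//.
  by apply: eq_Rintegral => x _; rewrite cReM.
rewrite -!RintegralZl// -RintegralD ?Z//.
by apply: eq_Rintegral => x _; rewrite cImM.
Qed.

Lemma cintegral0 : cintegral D (fun=> 0) = 0.
Proof.
by apply: cplx_eq; rewrite /= /Rintegral integral0.
Qed.

Lemma cintegralB f g : cintegrable D f -> cintegrable D g ->
  cintegral D (fun x => f x - g x) = cintegral D f - cintegral D g.
Proof.
move=> fI gI; rewrite -mulN1r -cintegralZ// -cintegralD//; last exact: cintegrableZ.
by apply: eq_cintegral => x _; rewrite mulN1r.
Qed.

Lemma cintegral_sum I (r : seq I) (P : pred I) (F : I -> R -> C) :
  (forall i, P i -> cintegrable D (F i)) ->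
  cintegral D (fun x => \sum_(i <- r | P i) F i x) =
  \sum_(i <- r | P i) cintegral D (F i).
Proof.
move=> FI; elim: r => [|i r IH].
  by rewrite big_nil -[RHS]cintegral0; apply: eq_cintegral => x _; rewrite big_nil.
rewrite big_cons; have [Pi|Pi] := boolP (P i); last first.
  by rewrite -IH; apply: eq_cintegral => x _; rewrite big_cons (negbTE Pi).
rewrite -IH -(cintegralD (FI i Pi) (cintegrable_sum r FI)).
by apply: eq_cintegral => x _; rewrite big_cons Pi.
Qed.

Lemma cintegral_conj f : cintegrable D f ->
  cintegral D (fun x => Num.conj (f x)) = Num.conj (cintegral D f).
Proof.
move=> [f1 f2]; rewrite conjE /cintegral /=; congr Complex.
  by apply: eq_Rintegral => x _; rewrite conjE.
by rewrite -mulN1r -RintegralZl//; apply: eq_Rintegral => x _; rewrite conjE mulN1r.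
Qed.

(** The factor 2 comes from bounding the real and imaginary parts separately. *)
Lemma cabs_cintegral_le f (N : set (measurableTypeR R)) (D' : set R) (g : R -> \bar R) :
  cintegrable D f -> mu.-negligible N -> (forall x, D' x -> (0 <= g x)%E) ->
  (forall x, D x -> ~ N x ->
     cabs (f x) = 0 \/ D' x /\ ((cabs (f x))%:E <= g x)%E) ->
  ((cabs (cintegral D f))%:E <= 2%:E * \int[mu]_(x in D') g x)%E.
Proof.
move=> [f1 f2] NN g0 fg.
have part (h : R -> R) : mu.-integrable D (EFin \o h) ->
    (forall x, `|h x| <= cabs (f x)) ->
    ((`|\int[mu]_(x in D) h x|)%:E <= \int[mu]_(x in D') g x)%E.
  move=> hI hf; rewrite EFin_normr_Rintegral//.
  apply: le_trans (le_abse_integral _ mD (measurable_int _ hI)) _.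
  rewrite -[leRHS]mul1e; apply: (ge0_integral_dominated _ NN) => // x Dx Nx.
  have [f0|[D'x fgx]] := fg x Dx Nx.
    by left; congr EFin; apply/eqP; rewrite eq_le normr_ge0 -f0 hf.
  by right; split=> //; rewrite mul1e; apply: le_trans fgx; rewrite lee_fin.
have le2 := cabs_leReIm (cintegral D f).
rewrite -lee_fin EFinD in le2; apply: le_trans le2 _.
rewrite (_ : 2%:E = 1 + 1)%E// ge0_muleDl// !mul1e; apply: leeD; apply: part => //.
  by move=> x; exact: cabs_geRe.
by move=> x; exact: cabs_geIm.
Qed.

End closure.
End complex_integral.

Section bochner_theory.
Context {R : realType}.
Local Notation C := R[i].
Local Notation mu := (@lebesgue_measure R).
Local Notation mR D := (@measurable _ (measurableTypeR R) D).

Lemma ereal_cvg0_lt (I : nat -> \bar R) (e : R) : 0 < e ->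
  I n @[n --> \oo] --> 0%E -> \forall n \near \oo, (I n < e%:E)%E.
Proof.
move=> e0 /fine_cvgP[If]; move=> /cvgrPdist_lt/(_ _ e0) H.
near=> n.
have /fineK <- : I n \is a fin_num by near: n.
rewrite lte_fin; apply: le_lt_trans (ler_norm _) _; rewrite -normrN -sub0r.
by near: n.
Unshelve. all: by end_near. Qed.

Lemma ereal_cvg0_dominated (I J : nat -> \bar R) (K : R) : 0 < K ->
  (forall n, 0 <= J n)%E -> (forall n, J n <= K%:E * I n)%E ->
  I n @[n --> \oo] --> 0%E -> J n @[n --> \oo] --> 0%E.
Proof.
move=> K0 J0 JI I0; apply: (@squeeze_cvge _ _ _ _ (cst 0%E) _ (fun n => K%:E * I n)%E).
- by apply: nearW => n; rewrite J0 JI.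
- exact: cvg_cst.
- by rewrite -(mule0 K%:E); apply: cvgeZl.
Qed.

Lemma integrable_of_bound D (h : R -> R) (M : R) : mR D -> (mu D < +oo)%E ->
  measurable_fun (D : set (measurableTypeR R)) h ->
  (forall x, D x -> `|h x| <= M) -> mu.-integrable D (EFin \o h).
Proof.
move=> mD muD mh hM; apply: measurable_bounded_integrable => //.
exists M; rewrite num_real; split=> // K MK x Dx /=.
by rewrite (le_trans (hM x Dx))// ltW.
Qed.

Section functional.
Variables (V : normedModType C) (l : V -> C^o).
Hypothesis bl : bounded_linear l.

Lemma functional_step_fun (s : step V) x :
  l (step_fun s x) = \sum_(i < step_size s)
    l (step_val i) * real_complex R (\1_(step_set i) x).
Proof.
rewrite /step_fun (blin_sum bl) big_mkcond /=; apply: eq_bigr => i _.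
rewrite indicE; case: asboolP => H.
  by rewrite mem_set// rmorph1 mulr1.
by rewrite memNset// rmorph0 mulr0.
Qed.

Lemma cintegrable_indic D A (c : C) : mR D -> mR A -> (mu D < +oo)%E ->
  cintegrable D (fun x => c * real_complex R (\1_A x)) /\
  cintegral D (fun x => c * real_complex R (\1_A x)) =
    real_complex R (fine (mu (D `&` A))) * c.
Proof.
move=> mD mA muD.
have I1 : cintegrable D (fun x => real_complex R (\1_A x)).
  split; last exact: integrable0.
  apply: (integrable_of_bound (M := 1) mD muD); first exact: measurable_indic.
  by move=> x _ /=; rewrite indicE; case: (_ \in _); rewrite ?normr1 ?normr0.
split; first exact: cintegrableZ.
rewrite cintegralZ// mulrC; congr (_ * _).
apply: cplx_eq => /=; last by rewrite /Rintegral integral0.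
by rewrite /Rintegral integral_indic// setIC.
Qed.

Lemma cintegral_step D (s : step V) : mR D -> (mu D < +oo)%E ->
  cintegrable D (fun x => l (step_fun s x)) /\
  cintegral D (fun x => l (step_fun s x)) = l (step_integral D s).
Proof.
move=> mD muD; have Ii (i : 'I_(step_size s)) := cintegrable_indic (l (step_val i)) mD (step_measurable i) muD.
have I : cintegrable D (fun x => \sum_(i < step_size s)
    l (step_val i) * real_complex R (\1_(step_set i) x)).
  by apply: cintegrable_sum => // i _; have [] := Ii i.
split; first by apply: (eq_cintegrable mD _ I) => x _; rewrite functional_step_fun.
rewrite (eq_cintegral (fun x _ => functional_step_fun s x)) cintegral_sum//; last by move=> i _; have [] := Ii i.
rewrite /step_integral (blin_sum bl); apply: eq_bigr => i _.
by rewrite (blinZ bl); have [_ ->] := Ii i.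
Qed.

(** The values of [l] on the approximating integrals converge both to [l v] and,
    since [l] is bounded, to the integral of [g].  The null set [N] leaves room
    to choose [g] measurable. *)
Lemma bochner_functional D (N : set (measurableTypeR R)) f v (g : R -> C) : mR D ->
  (mu D < +oo)%E -> is_bochner_integral D f v -> cintegrable D g ->
  mu.-negligible N -> (forall x, D x -> ~ N x -> l (f x) = g x) ->
  l v = cintegral D g.
Proof.
move=> mD muD [s [_ s0 sv]] gI NN fg.
have [K K0 lK] := bounded_linear_bound bl.
have c1 : l (step_integral D (s n)) @[n --> \oo] --> l v by exact: (blin_cvg bl).
apply: (cvg_unique_rnorm c1); apply/cvg_rnormP => e e0.
have e2 : 0 < e / (2 * K) by rewrite divr_gt0// mulr_gt0.
apply: filterS (ereal_cvg0_lt e2 s0) => n Hn.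
have [sI <-] := cintegral_step (s n) mD muD.
rewrite rnorm_cabs -(cintegralB mD)// -lte_fin.
have dI : cintegrable D (fun x => l (step_fun (s n) x) - g x).
  apply: cintegrableD => //; have := cintegrableZ mD (-1) gI.
  by move=> H; apply: (eq_cintegrable mD _ H) => x _; rewrite mulN1r.
have r0 x : (0 <= (rnorm (f x - step_fun (s n) x))%:E)%E by rewrite lee_fin rnorm_ge0.
apply: le_lt_trans (cabs_cintegral_le (D' := D)
  (g := fun x => (K * rnorm (f x - step_fun (s n) x))%:E) mD dI NN _ _) _.
- by move=> x _; rewrite lee_fin mulr_ge0 ?rnorm_ge0 ?ltW.
- move=> x Dx Nx; right; split => //; rewrite lee_fin -(fg x Dx Nx).
  by rewrite -(blinB bl) rnormB -rnorm_cabs; apply: lK.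
have K1 : (\int[mu]_(x in D) (K * rnorm (f x - step_fun (s n) x))%:E <=
    K%:E * \int[mu]_(x in D) (rnorm (f x - step_fun (s n) x))%:E)%E.
  apply: (ge0_integral_dominated K0 (negligible_set0 mu)) => // x Dx.
    by rewrite lee_fin mulr_ge0 ?rnorm_ge0 ?ltW.
  by move=> _; right; split => //; rewrite EFinM.
apply: le_lt_trans (lee_wpmul2l _ K1) _; first by rewrite lee_fin.
rewrite muleA -EFinM muleC -lte_pdivlMr ?mulr_gt0//.
Qed.

End functional.

(** The approximating step functions are truncated to [0, a] and their values
    mapped by [L]. *)
Lemma bochner_image (E F : normedModType C) (L : E -> F) (a b : R) f f' v :
  bounded_linear L -> a <= b -> is_bochner_integral `[0, a] f v ->
  (forall x, 0 <= x -> x <= a -> f' x = L (f x)) ->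
  (forall x, a < x -> x <= b -> f' x = 0) ->
  is_bochner_integral `[0, b] f' (L v).
Proof.
move=> bL ab [s [sae s0 sv]] f'a f'b.
have [K K0 LK] := bounded_linear_bound bL.
have mI (A : set R) : mR A -> mR (A `&` `[0, a]).
  by move=> mA; apply: measurableI => //; exact: measurable_itv.
pose s' n : step F := Step (fun i : 'I_(step_size (s n)) => L (step_val i))
   (fun i => mI _ (step_measurable i)).
have s'E n x : step_fun (s' n) x =
    if x \in `[0, a] then L (step_fun (s n) x) else 0.
  rewrite /step_fun /=; case: ifPn => xa.
    rewrite (blin_sum bL); apply: eq_bigl => i; apply/asbool_equiv_eq.
    by split=> [[]//|H]; split.
  by rewrite big_pred0// => i; apply/asboolPn => -[_ xa']; case/negP: xa.
exists s'; split.
- apply: (negligibleS _ sae) => x /=; apply: contra_not => Hx xb.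
  under eq_fun do rewrite s'E.
  move: xb; rewrite in_itv/= => /andP[x0 xb].
  have [xa|xa] := leP x a.
    rewrite in_itv/= x0 xa /= f'a//; apply: (blin_cvg bL); apply: Hx.
    by rewrite /= in_itv/= x0.
  by rewrite in_itv/= x0 leNgt xa /= f'b//; exact: cvg_cst.
- apply: (ereal_cvg0_dominated K0 _ _ s0) => n.
    by apply: integral_ge0 => x _; rewrite lee_fin rnorm_ge0.
  apply: (ge0_integral_dominated K0 (negligible_set0 mu)) => //.
  + by move=> x _; rewrite lee_fin rnorm_ge0.
  + by move=> x _; rewrite lee_fin rnorm_ge0.
  move=> x /=; rewrite in_itv/= => /andP[x0 xb] _.
  rewrite s'E !in_itv/= x0 /=; have [xa|xa] := leP x a.
    by right; split => //; rewrite -EFinM lee_fin f'a// -(blinB bL) LK.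
  by left; rewrite f'b// subrr rnorm0.
- rewrite (_ : (fun _ => _) = fun n => L (step_integral `[0, a] (s n))).
    exact: (blin_cvg bL).
  apply/funext => n; rewrite /step_integral (blin_sum bL).
  apply: eq_bigr => i _; rewrite (blinZ bL) /=.
  congr (real_complex R (fine (mu _)) *: _); apply/seteqP; split => x /=.
    by rewrite !in_itv/= => -[_ []].
  rewrite !in_itv/= => -[/andP[x0 xa] Ax]; split; first by rewrite x0 (le_trans xa).
  by split => //; rewrite x0.
Qed.

End bochner_theory.

(** * The space of square integrable functions *)

Section L2_space.
Context {R : realType}.
Local Notation C := R[i].
Local Notation mu := (@lebesgue_measure R).
Local Notation mR D := (@measurable _ (measurableTypeR R) D).
Variable s : R.
Local Notation D := (`[0%R, s]%classic).

Let mD : mR D. Proof. exact: measurable_itv. Qed.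

Let muD : (mu D < +oo)%E.
Proof. by rewrite lebesgue_measure_itv/=; case: ifPn => // _; rewrite -EFinB ltry. Qed.

Lemma L2_sqr_integrable u : in_L2 s u ->
  mu.-integrable D (EFin \o (fun t => cabs (u t) ^+ 2)).
Proof.
move=> [mre mim u2]; apply/integrableP; split; last first.
  apply: le_lt_trans u2; rewrite le_eqVlt; apply/orP; left; apply/eqP.
  by apply: eq_integral => x _ /=; rewrite ger0_norm ?sqr_ge0.
apply/measurable_EFinP.
apply: (eq_measurable_fun (fun t => complex.Re (u t) ^+ 2 + complex.Im (u t) ^+ 2)).
  by move=> x _; rewrite cabs_sqr.
by apply: measurable_funD; apply: measurable_funX.
Qed.

Lemma L2_of_bound u v w (a : R) : in_L2 s v -> in_L2 s w ->
  measurable_fun D (fun t => complex.Re (u t)) ->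
  measurable_fun D (fun t => complex.Im (u t)) ->
  (forall t, D t -> cabs (u t) ^+ 2 <= a * (cabs (v t) ^+ 2 + cabs (w t) ^+ 2)) ->
  in_L2 s u.
Proof.
move=> vL wL mre mim uvw; split=> //.
have := integrableZl mD a (integrableD mD (L2_sqr_integrable vL) (L2_sqr_integrable wL)).
move=> /integrableP[mg]; apply: le_lt_trans.
apply: ge0_le_integral => //.
- by move=> x _; rewrite lee_fin sqr_ge0.
- apply/measurable_EFinP.
  apply: (eq_measurable_fun (fun t => complex.Re (u t) ^+ 2 + complex.Im (u t) ^+ 2)).
    by move=> x _; rewrite -cabs_sqr.
  by apply: measurable_funD; apply: measurable_funX.
- exact: measurableT_comp.
- move=> x Dx /=; rewrite lee_fin (le_trans _ (ler_norm _))//; exact: uvw.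
Qed.

Lemma in_L2_0 : in_L2 s (fun=> 0).
Proof.
split; [exact: measurable_cst|exact: measurable_cst|].
rewrite integral0_eq// => x _; congr EFin.
by rewrite [X in X ^+ 2](@rnorm0 _ C^o) expr0n.
Qed.

Lemma in_L2D u v : in_L2 s u -> in_L2 s v -> in_L2 s (fun t => u t + v t).
Proof.
move=> uL vL; have [ru iu _] := uL; have [rv iv _] := vL.
apply: (L2_of_bound (a := 2) uL vL).
- apply: (eq_measurable_fun (fun t => complex.Re (u t) + complex.Re (v t))).
    by move=> x _; rewrite cReD.
  exact: measurable_funD.
- apply: (eq_measurable_fun (fun t => complex.Im (u t) + complex.Im (v t))).
    by move=> x _; rewrite cImD.
  exact: measurable_funD.
- move=> t _; have := cabsD (u t) (v t).
  move: (cabs_ge0 (u t + v t)) (cabs_ge0 (u t)) (cabs_ge0 (v t)).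
  move: (cabs (u t + v t)) (cabs (u t)) (cabs (v t)) => p q r p0 q0 r0 pqr.
  have := ler_pM p0 p0 pqr pqr; have := sqr_ge0 (q - r); rewrite !expr2; nra.
Qed.

Lemma in_L2Z a u : in_L2 s u -> in_L2 s (fun t => a * u t).
Proof.
move=> uL; have [ru iu _] := uL.
apply: (L2_of_bound (a := cabs a ^+ 2) uL in_L2_0).
- apply: (eq_measurable_fun (fun t => complex.Re a * complex.Re (u t) -
      complex.Im a * complex.Im (u t))).
    by move=> x _; rewrite cReM.
  by apply: measurable_funB; apply: measurable_funM => //; exact: measurable_cst.
- apply: (eq_measurable_fun (fun t => complex.Re a * complex.Im (u t) +
      complex.Im a * complex.Re (u t))).
    by move=> x _; rewrite cImM.
  by apply: measurable_funD; apply: measurable_funM => //; exact: measurable_cst.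
- by move=> t _; rewrite cabsM exprMn cabs0 expr0n addr0.
Qed.

Lemma in_L2_conj u : in_L2 s u -> in_L2 s (fun t => Num.conj (u t)).
Proof.
move=> uL; have [ru iu _] := uL.
apply: (L2_of_bound (a := 1) uL in_L2_0).
- by apply: (eq_measurable_fun (fun t => complex.Re (u t))) => // x _; rewrite conjE.
- apply: (eq_measurable_fun (fun t => - complex.Im (u t))).
    by move=> x _; rewrite conjE.
  exact: measurable_funN.
- by move=> t _; rewrite cabs_conj mul1r lerDl sqr_ge0.
Qed.

Lemma in_L2B u v : in_L2 s u -> in_L2 s v -> in_L2 s (fun t => u t - v t).
Proof.
move=> uL /(in_L2Z (-1)) vL; have := in_L2D uL vL.
by rewrite (_ : (fun t => u t - v t) = (fun t => u t + -1 * v t))//;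
  apply/funext => t; rewrite mulN1r.
Qed.

Lemma in_L2_sum I (r : seq I) (P : pred I) (u : I -> R -> C) :
  (forall i, P i -> in_L2 s (u i)) ->
  in_L2 s (fun t => \sum_(i <- r | P i) u i t).
Proof.
move=> uL; elim: r => [|i r IH].
  by under eq_fun do rewrite big_nil; exact: in_L2_0.
have [Pi|Pi] := boolP (P i); last first.
  by under eq_fun do rewrite big_cons (negbTE Pi).
by under eq_fun do rewrite big_cons Pi; apply: in_L2D => //; exact: uL.
Qed.

Lemma L2_mul_integrable u v : in_L2 s u -> in_L2 s v ->
  cintegrable D (fun t => u t * v t).
Proof.
move=> uL vL; have [ru iu _] := uL; have [rv iv _] := vL.
have I := integrableD mD (L2_sqr_integrable uL) (L2_sqr_integrable vL).
have bnd t (x : R) : `|x| <= cabs (u t * v t) ->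
   `|x| <= `|cabs (u t) ^+ 2 + cabs (v t) ^+ 2|.
  rewrite cabsM => /le_trans; apply; rewrite (le_trans _ (ler_norm _))//.
  move: (cabs_ge0 (u t)) (cabs_ge0 (v t)).
  by move: (cabs _) (cabs _) => q r q0 r0; have := sqr_ge0 (q - r); rewrite !expr2; nra.
split; apply: (le_integrable mD _ _ I).
- apply/measurable_EFinP; apply: (eq_measurable_fun (fun t =>
    complex.Re (u t) * complex.Re (v t) - complex.Im (u t) * complex.Im (v t))).
    by move=> x _; rewrite cReM.
  by apply: measurable_funB; apply: measurable_funM.
- by move=> t _ /=; rewrite lee_fin bnd// cabs_geRe.
- apply/measurable_EFinP; apply: (eq_measurable_fun (fun t =>
    complex.Re (u t) * complex.Im (v t) + complex.Im (u t) * complex.Re (v t))).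
    by move=> x _; rewrite cImM.
  by apply: measurable_funD; apply: measurable_funM.
- by move=> t _ /=; rewrite lee_fin bnd// cabs_geIm.
Qed.

Definition L2sqr (u : R -> C) : R := complex.Re (L2dot s u u).

Lemma L2sqrE u : L2sqr u = \int[mu]_(t in D) (cabs (u t) ^+ 2).
Proof. by apply: eq_Rintegral => t _; rewrite mulr_conjE. Qed.

Lemma L2dot_self u : L2dot s u u = real_complex R (L2sqr u).
Proof.
apply: cplx_eq => //=; rewrite /Rintegral integral0_eq// => x _.
by rewrite mulr_conjE.
Qed.

Lemma L2sqr_ge0 u : 0 <= L2sqr u.
Proof. by rewrite L2sqrE; apply: Rintegral_ge0 => x _; rewrite sqr_ge0. Qed.

Lemma L2sqr_EFin u : in_L2 s u ->
  (L2sqr u)%:E = (\int[mu]_(t in D) (cabs (u t) ^+ 2)%:E)%E.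
Proof.
by move=> uL; rewrite L2sqrE /Rintegral fineK//; apply: integrable_fin_num => //;
  exact: L2_sqr_integrable.
Qed.

Lemma L2sqr_lt_of_norm u (e : R) : 0 < e -> L2norm s u < e -> L2sqr u < e ^+ 2.
Proof.
move=> e0 ue; rewrite -(@sqr_sqrtr _ (L2sqr u)) ?L2sqr_ge0//.
by rewrite ltr_pXn2r// ?nnegrE ?sqrtr_ge0 ?ltW.
Qed.

Section sesquilinear.
Variables u v : R -> C.
Hypotheses (uL : in_L2 s u) (vL : in_L2 s v).

Let uvI := L2_mul_integrable uL (in_L2_conj vL).

Lemma L2dot_conj : L2dot s v u = Num.conj (L2dot s u v).
Proof.
rewrite /L2dot -cintegral_conj//; apply: eq_cintegral => t _.
by rewrite rmorphM /= conjCK mulrC.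
Qed.

Lemma L2dot_suml I (r : seq I) (P : pred I) (a : I -> C) (f : I -> R -> C) :
  (forall i, P i -> in_L2 s (f i)) ->
  L2dot s (fun t => \sum_(i <- r | P i) a i * f i t) v =
  \sum_(i <- r | P i) a i * L2dot s (f i) v.
Proof.
move=> fL; have I1 i : P i -> cintegrable D (fun t => f i t * Num.conj (v t)).
  by move=> Pi; apply: L2_mul_integrable; [exact: fL|exact: in_L2_conj].
rewrite /L2dot -(eq_bigr _ (fun i Pi => cintegralZ mD (a i) (I1 i Pi))).
rewrite -cintegral_sum//; last by move=> i Pi; apply: cintegrableZ => //; exact: I1.
by apply: eq_cintegral => t _; rewrite mulr_suml; apply: eq_bigr => i _; rewrite mulrA.
Qed.

Lemma L2sqrB : L2sqr (fun t => u t - v t) =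
  L2sqr u - 2 * complex.Re (L2dot s u v) + L2sqr v.
Proof.
have uu := L2_mul_integrable uL (in_L2_conj uL).
have vv := L2_mul_integrable vL (in_L2_conj vL).
have vu := L2_mul_integrable vL (in_L2_conj uL).
have E : L2dot s (fun t => u t - v t) (fun t => u t - v t) =
    (L2dot s u u + L2dot s v v) + -1 * (L2dot s u v + L2dot s v u).
  rewrite /L2dot -!cintegralD// -cintegralZ//; last exact: cintegrableD.
  rewrite -cintegralD//; [|exact: cintegrableD|]; last first.
    by apply: cintegrableZ => //; exact: cintegrableD.
  by apply: eq_cintegral => t _; rewrite rmorphB /=; ring.
rewrite /L2sqr E L2dot_conj mulN1r !(cReD, cReN) [Num.conj _]conjE /=; ring.
Qed.

(** Cauchy-Schwarz followed by the weighted arithmetic-geometric inequality. *)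
Lemma cabs_cintegral_mul (e : R) : 0 < e ->
  cabs (cintegral D (fun t => u t * v t)) <= e * L2sqr u + e^-1 * L2sqr v.
Proof.
move=> e0; rewrite -lee_fin.
have := @cabs_cintegral_le _ D mD (fun t => u t * v t) set0 D
  (fun t => (2^-1 * (e * cabs (u t) ^+ 2 + e^-1 * cabs (v t) ^+ 2))%:E).
move=> /(_ (L2_mul_integrable uL vL) (negligible_set0 mu)) H.
apply: le_trans (H _ _) _ => {H}.
- by move=> t _; rewrite lee_fin mulr_ge0// addr_ge0// mulr_ge0 ?sqr_ge0 ?invr_ge0 ?ltW.
- move=> t Dt _; right; split => //; rewrite lee_fin cabsM.
  have : 0 <= (e * cabs (u t) - cabs (v t)) ^+ 2 * e^-1.
    by rewrite mulr_ge0 ?sqr_ge0// invr_ge0 ltW.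
  rewrite (_ : (_ - _) ^+ 2 * _ = e * cabs (u t) ^+ 2 + e^-1 * cabs (v t) ^+ 2
    - 2 * (cabs (u t) * cabs (v t))); first lra.
  by field; rewrite lt0r_neq0.
have Iu := integrableZl mD e (L2_sqr_integrable uL).
have Iv := integrableZl mD e^-1 (L2_sqr_integrable vL).
rewrite [leRHS]EFinD [X in (_ <= X + _)%E]EFinM [X in (_ <= _ + X)%E]EFinM.
rewrite (L2sqr_EFin uL) (L2sqr_EFin vL).
rewrite -(integralZl mD (L2_sqr_integrable uL)) -(integralZl mD (L2_sqr_integrable vL)).
have I2 := integrableZl mD 2^-1 (integrableD mD Iu Iv).
rewrite -integralD// le_eqVlt; apply/orP; left; apply/eqP.
rewrite -(integralZl mD I2); apply: eq_integral => t _ /=.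
by rewrite -!EFinM -EFinD; congr EFin; rewrite mulrA divff ?mul1r// pnatr_eq0.
Qed.

End sesquilinear.

End L2_space.

Section L2_complete.
Context {R : realType}.
Local Notation C := R[i].
Local Notation mu := (@lebesgue_measure R).
Local Notation mR D := (@measurable _ (measurableTypeR R) D).

(** Cauchy-Schwarz with weights 2^j, obtained by peeling off the first term. *)
Lemma sqr_telescope_le (f : nat -> R) (k n : nat) :
  (f (k + n)%N - f k) ^+ 2 <=
  2 * 2^-1 ^+ k * \sum_(j < n) 2 ^+ (k + j) * (f (k + j).+1 - f (k + j)%N) ^+ 2.
Proof.
elim: n k => [|n IH] k; first by rewrite addn0 subrr expr0n big_ord0 mulr0.
have := IH k.+1; rewrite addSnnS => H.
rewrite big_ord_recl addn0 /=.
rewrite (eq_bigr (fun j : 'I_n => 2 ^+ (k.+1 + j) *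
  (f (k.+1 + j).+1 - f (k.+1 + j)%N) ^+ 2)); last first.
  by move=> j _; rewrite /bump /= add1n addSnnS.
move: H; set S := \sum_(j < n) _; set X := f _ - f k.+1 => H.
have -> : f (k + n.+1)%N - f k = X + (f k.+1 - f k) by rewrite /X; ring.
set d := f k.+1 - f k.
have p2 : 2^-1 ^+ k * 2 ^+ k = 1 :> R by rewrite -exprMn mulVf ?expr1n// pnatr_eq0.
have -> : 2 * 2^-1 ^+ k * (2 ^+ k * d ^+ 2 + S) =
    2 * (2^-1 ^+ k * 2 ^+ k) * d ^+ 2 + 2 * (2^-1 ^+ k * S) by ring.
have e2 : 2 * 2^-1 ^+ k.+1 = 2^-1 ^+ k :> R.
  by rewrite exprS mulrA divff ?mul1r// pnatr_eq0.
rewrite p2 mulr1; rewrite e2 in H.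
have := sqr_ge0 (X - d); rewrite !expr2 in H *; nra.
Qed.

Section real_valued.
Variables (D : set R) (f : nat -> R -> R).
Hypothesis mD : mR D.
Hypothesis mf : forall k, measurable_fun (D : set (measurableTypeR R)) (f k).
Hypothesis fast : forall k,
  (\int[mu]_(x in D) ((f k.+1 x - f k x) ^+ 2)%:E <= (4^-1 ^+ k)%:E)%E.

(** [H] dominates all increments at once: [|f (k + n) - f k| ^ 2] is at most
    [2 * 2 ^ -k * H].  Being integrable it is finite almost everywhere. *)
Let H x : \bar R := (\sum_(k <oo) (2 ^+ k * (f k.+1 x - f k x) ^+ 2)%:E)%E.

Let term_ge0 k x : (0 <= (2 ^+ k * (f k.+1 x - f k x) ^+ 2)%:E)%E.
Proof. by rewrite lee_fin mulr_ge0 ?sqr_ge0 ?exprn_ge0. Qed.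

Let H_ge0 x : (0 <= H x)%E.
Proof. by apply: nneseries_ge0 => k _ _; exact: term_ge0. Qed.

Let mterm k : measurable_fun (D : set (measurableTypeR R))
  (fun x => (2 ^+ k * (f k.+1 x - f k x) ^+ 2)%:E).
Proof.
apply/measurable_EFinP; apply: measurable_funM; first exact: measurable_cst.
by apply: measurable_funX; apply: measurable_funB.
Qed.

Let mH : measurable_fun (D : set (measurableTypeR R)) H.
Proof. by apply: ge0_emeasurable_sum => // k x _ _; exact: term_ge0. Qed.

Let int_H : (\int[mu]_(x in D) H x <= 2%:E)%E.
Proof.
rewrite integral_nneseries//.
have half0 k : (0 <= (2^-1 ^+ k : R)%:E)%E by rewrite lee_fin exprn_ge0 ?invr_ge0.
have geo : (\sum_(k <oo) (2^-1 ^+ k : R)%:E <= 2%:E)%E.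
  apply: lime_le; first by apply: is_cvg_nneseries => k _ _; exact: half0.
  apply: nearW => n; rewrite sumEFin lee_fin.
  suff E : \sum_(0 <= k < n) 2^-1 ^+ k + 2 * 2^-1 ^+ n = 2 :> R.
    by rewrite -[leRHS]E lerDl mulr_ge0 ?exprn_ge0 ?invr_ge0.
  elim: n => [|n IH]; first by rewrite big_nil expr0 add0r mulr1.
  rewrite big_nat_recr//= -[RHS]IH exprS; by field.
apply: le_trans geo; apply: lee_nneseries => [k _ _|k _]; first by apply: integral_ge0 => x _; exact: term_ge0.
have m2 : measurable_fun (D : set (measurableTypeR R)) (fun x => ((f k.+1 x - f k x) ^+ 2)%:E).
  by apply/measurable_EFinP; apply: measurable_funX; apply: measurable_funB.
under eq_integral do rewrite EFinM.
rewrite ge0_integralZl//; last by move=> x _; rewrite lee_fin sqr_ge0.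
apply: le_trans (lee_wpmul2l _ (fast k)) _; first by rewrite lee_fin exprn_ge0.
rewrite -EFinM lee_fin -exprMn.
by rewrite (_ : 2 * 4^-1 = 2^-1 :> R)//; field.
Qed.

Let null : mu.-negligible (D `&` [set x | H x = +oo%E]).
Proof.
have HI : mu.-integrable D H.
  apply/integrableP; split => //.
  under eq_integral do rewrite gee0_abs//.
  by apply: le_lt_trans int_H _; rewrite ltry.
apply: (negligibleS _ (integrable_ae mD HI)) => x [Dx Hx] /(_ Dx).
by rewrite Hx.
Qed.

Let increment_le x k n : (H x < +oo)%E ->
  (f (k + n)%N x - f k x) ^+ 2 <= 2 * 2^-1 ^+ k * fine (H x).
Proof.
move=> Hx; apply: le_trans (sqr_telescope_le (f ^~ x) k n) _.
rewrite ler_wpM2l ?mulr_ge0 ?exprn_ge0 ?invr_ge0//.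
rewrite -lee_fin fineK ?ge0_fin_numE// -sumEFin.
have := nneseries_lim_ge (k + n) (m := 0) (P := xpredT) (fun j _ _ => term_ge0 j x).
apply: le_trans.
rewrite (@big_cat_nat _ _ _ k) ?leq_addr//=.
have shift (a : nat -> \bar R) :
    (\sum_(k <= j < k + n) a j = \sum_(j < n) a (k + j)%N)%E.
  rewrite -{1}[k]add0n big_addn addKn big_mkord.
  by apply: eq_bigr => j _; rewrite addnC.
rewrite shift.
by apply: leeDr; apply: sume_ge0 => j _; exact: term_ge0.
Qed.

Let cvg_off x : (H x < +oo)%E -> cvg (f n x @[n --> \oo]).
Proof.
move=> Hx; apply: cauchy_cvg; apply: cauchy_exP => e e0.
have small : (2 * 2^-1 ^+ k * fine (H x)) @[k --> \oo] --> (0 : R).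
  rewrite -(mul0r (fine (H x))) -(mulr0 2); apply: cvgMr_tmp; apply: cvgMl_tmp.
  by apply: cvg_expr; rewrite ger0_norm ?invf_lt1 ?ltr1n.
have e20 : 0 < e ^+ 2 by rewrite exprn_gt0.
have [k _ Hk] := (cvgrPdist_lt _ _).1 small _ e20.
exists (f k x); exists k => // n /= kn.
rewrite -ball_normE /= -(@ltr_pXn2r _ 2)// ?nnegrE ?ltW// real_normK ?num_real//.
rewrite -sqrrN opprB -(subnKC kn); apply: le_lt_trans (increment_le _ _ Hx) _.
have := Hk k (leqnn k); rewrite /= sub0r normrN; apply: le_lt_trans.
exact: ler_norm.
Qed.

(** Where [H] is finite the sequence is Cauchy, hence converges; the same bound
    on the increments, passed to the limit and integrated, gives the rate. *)
Lemma real_L2_complete : exists2 g : R -> R,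
  measurable_fun (D : set (measurableTypeR R)) g &
  forall k, (\int[mu]_(x in D) ((g x - f k x) ^+ 2)%:E <= (4 * 2^-1 ^+ k)%:E)%E.
Proof.
pose g x := fine (limn_esup (fun n => (f n x)%:E)).
have gE x : (H x < +oo)%E -> f n x @[n --> \oo] --> g x.
  move=> Hx; have fl := cvg_off Hx.
  have := @cvg_limn_einf_sup _ (fun n => (f n x)%:E) (lim (f n x @[n --> \oo]))%:E.
  by rewrite /g => -[|_ ->] //; apply/fine_cvgP; split; [exact: nearW|exact: fl].
exists g.
  apply: measurableT_comp; first exact: fine_measurable.
  by apply: measurable_fun_limn_esup => n; apply/measurable_EFinP.
move=> k.
have K0 : 0 < 2 * 2^-1 ^+ k :> R by rewrite mulr_gt0// exprn_gt0// invr_gt0.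
apply: le_trans (_ : ((2 * 2^-1 ^+ k)%:E * \int[mu]_(x in D) H x <= _)%E); last first.
  apply: le_trans (lee_wpmul2l _ int_H) _; first by rewrite lee_fin ltW.
  rewrite -EFinM lee_fin; lra.
apply: (ge0_integral_dominated K0 null) => //.
  by move=> x _; rewrite lee_fin sqr_ge0.
move=> x Dx; rewrite /= => nH; right; split => //.
have Hx : (H x < +oo)%E.
  by rewrite ltey; apply/eqP => Hx; apply: nH.
rewrite -(fineK (_ : H x \is a fin_num)) ?ge0_fin_numE// -EFinM lee_fin.
have lim2 : (f n x - f k x) ^+ 2 @[n --> \oo] --> (g x - f k x) ^+ 2.
  by rewrite expr2; under eq_fun do rewrite expr2; apply: cvgM;
    apply: cvgB; [exact: gE|exact: cvg_cst|exact: gE|exact: cvg_cst].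
rewrite -(cvg_lim (@Rhausdorff R) lim2).
apply: limr_le; first by apply/cvg_ex; eexists; exact: lim2.
near=> n; have kn : (k <= n)%N by near: n; exists k.
by rewrite -(subnKC kn); exact: increment_le.
Unshelve. all: by end_near. Qed.

End real_valued.

End L2_complete.

(** * The moment problem *)

Section moments.
Context {R : realType}.
Local Notation C := R[i].
Local Notation mu := (@lebesgue_measure R).
Local Notation mR D := (@measurable _ (measurableTypeR R) D).
Variable s : R.
Local Notation D := (`[0%R, s]%classic).

Let mD : mR D. Proof. exact: measurable_itv. Qed.

Lemma L2_complete (u : nat -> R -> C) : (forall k, in_L2 s (u k)) ->
  (forall k, L2sqr s (fun t => u k.+1 t - u k t) <= 4^-1 ^+ k) ->
  exists2 v, in_L2 s v & forall k, L2sqr s (fun t => v t - u k t) <= 8 * 2^-1 ^+ k.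
Proof.
move=> uL fast.
have dL k : in_L2 s (fun t => u k.+1 t - u k t) by apply: in_L2B.
have part (p : C -> R) : (forall z, p z ^+ 2 <= cabs z ^+ 2) ->
    {morph p : x y / x - y} ->
    (forall k, measurable_fun (D : set (measurableTypeR R)) (fun t => p (u k t))) ->
    exists2 g : R -> R, measurable_fun (D : set (measurableTypeR R)) g & forall k,
      (\int[mu]_(x in D) ((g x - p (u k x)) ^+ 2)%:E <= (4 * 2^-1 ^+ k)%:E)%E.
  move=> pz pB mp; apply: (real_L2_complete (f := fun k t => p (u k t))) => // k.
  have := fast k; rewrite -lee_fin (L2sqr_EFin (dL k)); apply: le_trans.
  rewrite -[leRHS]mul1e; apply: (ge0_integral_dominated _ (negligible_set0 mu)) => //.
  - by move=> x _; rewrite lee_fin sqr_ge0.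
  - by move=> x _; rewrite lee_fin sqr_ge0.
  - by move=> x Dx _; right; split => //; rewrite mul1e lee_fin -pB pz.
have [| | |g1 mg1 Hg1] := part (fun z => complex.Re z).
- by move=> z; rewrite cabs_sqr lerDl sqr_ge0.
- by move=> x y; rewrite cReD cReN.
- by move=> k; have [] := uL k.
have [| | |g2 mg2 Hg2] := part (fun z => complex.Im z).
- by move=> z; rewrite cabs_sqr lerDr sqr_ge0.
- by move=> x y; rewrite cImD cImN.
- by move=> k; have [] := uL k.
pose v t := Complex (g1 t) (g2 t).
have vu k : (\int[mu]_(t in D) (cabs (v t - u k t) ^+ 2)%:E <= (8 * 2^-1 ^+ k)%:E)%E.
  have [mr mi _] := uL k.
  under eq_integral do rewrite cabs_sqr cReD cReN cImD cImN /= EFinD.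
  rewrite ge0_integralD//.
  - have -> : (8 * 2^-1 ^+ k)%:E = ((4 * 2^-1 ^+ k)%:E + (4 * 2^-1 ^+ k)%:E)%E :> \bar R.
      by rewrite -EFinD; congr EFin; ring.
    by apply: leeD; [exact: Hg1|exact: Hg2].
  - by move=> x _; rewrite lee_fin sqr_ge0.
  - by apply/measurable_EFinP; apply: measurable_funX; apply: measurable_funB.
  - by move=> x _; rewrite lee_fin sqr_ge0.
  - by apply/measurable_EFinP; apply: measurable_funX; apply: measurable_funB.
have vuL k : in_L2 s (fun t => v t - u k t).
  have [mr mi _] := uL k; split.
  - apply: (eq_measurable_fun (fun t => g1 t - complex.Re (u k t))).
      by move=> x _; rewrite cReD cReN.
    exact: measurable_funB.
  - apply: (eq_measurable_fun (fun t => g2 t - complex.Im (u k t))).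
      by move=> x _; rewrite cImD cImN.
    exact: measurable_funB.
  - by apply: le_lt_trans (vu k) _; rewrite ltry.
exists v; last by move=> k; rewrite -lee_fin L2sqr_EFin.
have := in_L2D (vuL 0%N) (uL 0%N).
by under eq_fun do rewrite subrK.
Qed.

Section moment_problem.
Variables (F : nat -> R -> C) (a : nat -> C) (gam M : R).
Hypothesis gam0 : 0 < gam.
Hypothesis FL : forall j, in_L2 s (F j).
Hypothesis riesz : forall n (c : nat -> C),
  gam * \sum_(i < n) cabs (c i) ^+ 2 <= L2sqr s (fun t => \sum_(i < n) c i * F i t).
Hypothesis aM : forall n, \sum_(i < n) cabs (a i) ^+ 2 <= M.

Let comb n (c : nat -> C) t := \sum_(i < n) c i * F i t.

Let combL n c : in_L2 s (comb n c).
Proof. by apply: in_L2_sum => i _; apply: in_L2Z. Qed.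

Let gram_unit n : gram s F n \in unitmx.
Proof.
rewrite unitmxE unitfE; apply/det0P => -[v v0 vG].
pose c k := if insub k is Some i then v 0 i else 0.
have cE (i : 'I_n) : c i = v 0 i by rewrite /c valK.
have dot0 (i : 'I_n) : L2dot s (comb n c) (F i) = 0.
  rewrite /comb L2dot_suml//.
  have := congr1 (fun A : 'rV_n => A 0 i) vG; rewrite mxE [RHS]mxE => H.
  by rewrite -[RHS]H; apply: eq_bigr => k _; rewrite cE mxE.
have sq0 : L2sqr s (comb n c) = 0.
  rewrite /L2sqr [X in L2dot s X _]/comb L2dot_suml// big1// => i _.
  by rewrite L2dot_conj// dot0 rmorph0 mulr0.
have := riesz n c; rewrite -/(comb n c) sq0 pmulr_rle0// => H.
case/eqP: v0; apply/rowP => i; rewrite mxE -cE; apply: cabs_eq0.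
apply/eqP; rewrite -sqrf_eq0 eq_le sqr_ge0 andbT; apply: le_trans H.
by rewrite (bigD1 i)//= lerDl sumr_ge0// => j _; rewrite sqr_ge0.
Qed.

Let truncated n : exists c : nat -> C, forall j, (j < n)%N ->
  L2dot s (F j) (comb n c) = a j.
Proof.
pose d := invmx (gram s F n) *m \col_(i < n) a i.
pose c k := if insub k is Some i then Num.conj (d i 0) else 0.
have cE (i : 'I_n) : c i = Num.conj (d i 0) by rewrite /c valK.
exists c => j jn; rewrite L2dot_conj// /comb L2dot_suml// rmorph_sum /=.
have H : (gram s F n *m d) (Ordinal jn) 0 = a j by rewrite mulKVmx// mxE.
rewrite -[RHS]H mxE; apply: eq_bigr => i _.
by rewrite rmorphM /= cE conjCK [gram _ _ _ _ _]mxE [in RHS]L2dot_conj// mulrC.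
Qed.

(** The truncated problem of order [n] has a solution [w n] in the span of the
    first [n] functions.  As [w m] has the same first [n] moments for [m >= n],
    [w m - w n] is orthogonal to [w n], so the squared norms increase by
    [|w m - w n| ^ 2]; they stay below [M / gam], which makes the sequence
    Cauchy. *)
Theorem moment_problem : exists2 w, in_L2 s w & forall j, L2dot s (F j) w = a j.
Proof.
have [c cP] := choice truncated.
pose w n := comb n (c n).
have wL n : in_L2 s (w n) by exact: combL.
have dotw n m : (n <= m)%N -> L2dot s (w n) (w m) = \sum_(i < n) c n i * a i.
  move=> nm; rewrite [X in L2dot s X]/w /comb L2dot_suml//.
  by apply: eq_bigr => i _; rewrite cP// (leq_trans _ nm).
pose E n := L2sqr s (w n).
have EM n : E n <= M / gam.
  have := riesz n (c n); rewrite -/(comb n (c n)) -/(w n) -/(E n) => r1.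
  suff : E n <= 2^-1 * (gam * \sum_(i < n) cabs (c n i) ^+ 2 + M / gam) by lra.
  rewrite /E /L2sqr dotw//.
  apply: le_trans (ler_norm _) _; apply: le_trans (cabs_geRe _) _.
  apply: le_trans (_ : \sum_(i < n) cabs (c n i * a i) <= _).
    elim/big_ind2: _ => //; first by rewrite cabs0.
    by move=> x x' y y' H1 H2; apply: le_trans (cabsD _ _) _; apply: lerD.
  apply: le_trans (_ : \sum_(i < n) 2^-1 * (gam * cabs (c n i) ^+ 2 +
      cabs (a i) ^+ 2 / gam) <= _).
    apply: ler_sum => i _; rewrite cabsM.
    have : 0 <= (gam * cabs (c n i) - cabs (a i)) ^+ 2 / gam.
      by rewrite divr_ge0 ?sqr_ge0 ?ltW.
    rewrite (_ : (_ - _) ^+ 2 / _ = gam * cabs (c n i) ^+ 2 + cabs (a i) ^+ 2 / gam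
      - 2 * (cabs (c n i) * cabs (a i))); first lra.
    by field; rewrite lt0r_neq0.
  rewrite -mulr_sumr big_split /= -mulr_sumr -mulr_suml.
  by rewrite ler_pM2l// lerD2l ler_pM2r ?invr_gt0//; exact: aM.
have pyth n m : (n <= m)%N -> L2sqr s (fun t => w n t - w m t) = E m - E n.
  move=> nm; rewrite L2sqrB// dotw// -(dotw n n)// -/(L2sqr s (w n)) -!/(E _); ring.
have Emono n m : (n <= m)%N -> E n <= E m.
  by move=> /pyth nm; rewrite -subr_ge0 -nm L2sqr_ge0.
have swap n m : L2sqr s (fun t => w n t - w m t) = L2sqr s (fun t => w m t - w n t).
  by rewrite !L2sqrE; apply: eq_Rintegral => t _; rewrite -cabsN opprB.
pose B := sup (range E).
have EB n : E n <= B.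
  by apply: ub_le_sup; [exists (M / gam) => _ [k _ <-]|exists n].
have pick k : exists n, (k <= n)%N /\ B - 4^-1 ^+ k < E n.
  have e0 : 0 < 4^-1 ^+ k :> R by rewrite exprn_gt0// invr_gt0.
  have hs : has_sup (range E).
    by split; [exists (E 0%N), 0%N|exists (M / gam) => _ [j _ <-]].
  have [_ [n _ <-] Hn] := sup_adherent e0 hs.
  exists (maxn k n); split; first exact: leq_maxl.
  by apply: lt_le_trans Hn _; apply: Emono; exact: leq_maxr.
have [N NP] := choice pick.
have [||v vL vP] := @L2_complete (fun k => w (N k)).
  by move=> k; exact: wL.
  move=> k; have [_ H1] := NP k; have [_ H2] := NP k.+1.
  have le4 : 4^-1 ^+ k.+1 <= 4^-1 ^+ k :> R.
    by rewrite exprS ger_pMl ?exprn_gt0 ?invr_gt0// invf_le1// ler1n.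
  have B1 := EB (N k); have B2 := EB (N k.+1).
  case/orP: (leq_total (N k) (N k.+1)) => NN; [rewrite swap|]; rewrite pyth//; lra.
exists v => // j.
apply/eqP; rewrite -subr_eq0; apply/eqP; apply: (@rnorm_le_eps _ C^o) => e e0.
rewrite rnorm_cabs.
pose q := e / (2 * (L2sqr s (F j) + 1)).
have FE0 := L2sqr_ge0 s (F j).
have q0 : 0 < q by rewrite divr_gt0// mulr_gt0// ltr_wpDl.
have [k jk Hk] : exists2 k, (j < k)%N & q^-1 * (8 * 2^-1 ^+ k) <= e / 2.
  have lim0 : q^-1 * (8 * 2^-1 ^+ k) @[k --> \oo] --> (0 : R).
    rewrite -(mulr0 q^-1) -(mulr0 8); do 2 apply: cvgMl_tmp.
    by apply: cvg_expr; rewrite ger0_norm ?invf_lt1 ?ltr1n.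
  have e20 : 0 < e / 2 by rewrite divr_gt0.
  have [k _ Hk] := (cvgrPdist_lt _ _).1 lim0 _ e20.
  exists (maxn k j.+1); first exact: leq_maxr.
  have := Hk (maxn k j.+1) (leq_maxl _ _); rewrite /= sub0r normrN => /ltW.
  exact: le_trans (ler_norm _).
have [Nk _] := NP k.
rewrite -(cP (N k) j) ?(leq_trans jk Nk)// -/(w (N k)).
have I1 := L2_mul_integrable (FL j) (in_L2_conj vL).
have I2 := L2_mul_integrable (FL j) (in_L2_conj (wL (N k))).
rewrite /L2dot -(cintegralB mD I1 I2).
have dL := in_L2B vL (wL (N k)).
have := cabs_cintegral_mul (FL j) (in_L2_conj dL) q0.
rewrite (eq_cintegral (g := fun t => F j t * Num.conj (v t) - F j t * Num.conj (w (N k) t))); last first.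
  by move=> t _; rewrite rmorphB /= mulrBr.
move=> /le_trans; apply; rewrite [e]splitr; apply: lerD.
  rewrite /q mulrAC ler_pdivrMr ?mulr_gt0 ?ltr_wpDl//.
  rewrite (_ : e / 2 * (2 * (L2sqr s (F j) + 1)) = e * L2sqr s (F j) + e); last by field.
  by rewrite lerDl ltW.
apply: le_trans Hk; rewrite ler_pM2l ?invr_gt0//; apply: le_trans (vP k).
rewrite le_eqVlt; apply/orP; left; apply/eqP; rewrite !L2sqrE.
by apply: eq_Rintegral => t _; rewrite cabs_conj.
Qed.

End moment_problem.
End moments.

(** * Gram matrices *)

Section gram_bound.
Context {R : realType}.
Local Notation C := R[i].
Local Open Scope sesquilinear_scope.

(** Diagonalizing in an orthonormal basis turns the form into a combination of
    squared moduli whose coefficients are eigenvalues. *)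
Lemma hermitian_form_ge (n : nat) (A : 'M[C]_n) (g : R) (v : 'rV[C]_n) :
  A \is hermsymmx -> is_min_eigenvalue A g ->
  real_complex R g * (v *m v^t*) 0 0 <= (v *m A *m v^t*) 0 0.
Proof.
move=> /hermitian_normalmx/orthomx_spectral_subproof[[P d] /= Pu AE] [_ gmin].
have Punit := unitarymx_unit Pu.
have deig i : real_complex R g <= d 0 i.
  apply: gmin; apply/eigenvalueP; exists (row i P).
    have PA : P *m A = diag_mx d *m P by rewrite AE !mulmxA mulmxV// mul1mx.
    by rewrite -row_mul PA; apply/rowP => j; rewrite mul_diag_mx !mxE.
  apply/eqP => Pi0; have : row i P *m invmx P = 0 by rewrite Pi0 mul0mx.
  rewrite -row_mul mulmxV// => /rowP/(_ i)/eqP.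
  by rewrite !mxE eqxx oner_eq0.
pose w := v *m P^t*.
have wE : w^t* = P *m v^t*.
  by rewrite /w trmx_mul map_mxM trmxCK.
have -> : v *m A *m v^t* = w *m diag_mx d *m w^t*.
  by rewrite AE invmx_unitary// wE /w !mulmxA.
have -> : v *m v^t* = w *m w^t*.
  by rewrite wE /w mulmxA mulmxKtV.
have term z e : real_complex R g <= e ->
    real_complex R g * (z * Num.conj z) <= z * e * Num.conj z.
  move=> ge; rewrite [z * e]mulrC -mulrA ler_wpM2r// mulr_conjE.
  by rewrite -(rmorph0 (real_complex R)) lecR sqr_ge0.
clearbody w; rewrite mul_mx_diag !mxE mulr_sumr; apply: ler_sum => i _.
by rewrite !mxE; exact: term.
Qed.

Variable s : R.

(** The smallest eigenvalues eventually exceed half of their limit, and a short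
    combination padded with zeros is controlled by a Gram matrix of large
    order. *)
Lemma gram_riesz (F : nat -> R -> C) : (forall j, in_L2 s (F j)) ->
  L2strongly_minimal s F -> exists2 gam : R, 0 < gam &
  forall n (c : nat -> C), gam * \sum_(i < n) cabs (c i) ^+ 2 <=
    L2sqr s (fun t => \sum_(i < n) c i * F i t).
Proof.
move=> FL [gam gmin [l l0 gl]].
exists (l / 2); first by rewrite divr_gt0.
have big n (c : nat -> C) : l / 2 <= gam n ->
    (l / 2) * \sum_(i < n.+1) cabs (c i) ^+ 2 <=
    L2sqr s (fun t => \sum_(i < n.+1) c i * F i t).
  move=> ln.
  have herm : gram s F n.+1 \is hermsymmx.
    rewrite is_hermitianmxE expr0 scale1r; apply/eqP/matrixP => i j.
    by rewrite !mxE L2dot_conj.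
  pose v : 'rV[C]_n.+1 := \row_i c i.
  have := hermitian_form_ge v herm (gmin n).
  have -> : (v *m gram s F n.+1 *m v^t*) 0 0 =
      real_complex R (L2sqr s (fun t => \sum_(i < n.+1) c i * F i t)).
    rewrite -L2dot_self.
    have wL : in_L2 s (fun t => \sum_(i < n.+1) c i * F i t).
      by apply: in_L2_sum => i _; apply: in_L2Z.
    rewrite L2dot_suml// -mulmxA mxE; apply: eq_bigr => i _; rewrite !mxE.
    congr (_ * _); rewrite L2dot_conj// L2dot_suml// rmorph_sum /=.
    apply: eq_bigr => j _; rewrite !mxE rmorphM /= mulrC.
    by rewrite [in LHS]L2dot_conj.
  have -> : (v *m v^t*) 0 0 = real_complex R (\sum_(i < n.+1) cabs (c i) ^+ 2).
    rewrite mxE rmorph_sum /=; apply: eq_bigr => i _.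
    by rewrite !mxE mulr_conjE.
  rewrite -rmorphM /= lecR; apply: le_trans.
  by rewrite ler_wpM2r// sumr_ge0// => i _; rewrite sqr_ge0.
move=> n c.
have l20 : 0 < l / 2 by rewrite divr_gt0.
have [N _ HN] := (cvgrPdist_lt _ _).1 gl _ l20.
pose m := maxn N n.
have lm : l / 2 <= gam m.
  have := HN m (leq_maxl _ _) => /=; rewrite ltr_distlC => /andP[]; lra.
pose c' i := if (i < n)%N then c i else 0.
have nm : (n <= m.+1)%N by rewrite leqW// leq_maxr.
have restr (V : zmodType) (h : nat -> V) (h' : nat -> V) :
    (forall i, (i < n)%N -> h i = h' i) -> (forall i, (n <= i)%N -> h' i = 0) ->
    \sum_(i < n) h i = \sum_(i < m.+1) h' i.
  move=> hh' h'0; rewrite (big_ord_widen _ h nm) big_mkcond; apply: eq_bigr => i _.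
  by case: ltnP => [/hh'//|/h'0 ->].
have := big m c' lm.
rewrite -(restr _ (fun i => cabs (c i) ^+ 2) (fun i => cabs (c' i) ^+ 2)); last 2 first.
- by move=> i ni; rewrite /c' ni.
- by move=> i ni; rewrite /c' ltnNge ni cabs0 expr0n.
suff -> : (fun t => \sum_(i < m.+1) c' i * F i t) = (fun t => \sum_(i < n) c i * F i t) by [].
apply/funext => t; apply/esym.
apply: (restr _ (fun i => c i * F i t) (fun i => c' i * F i t)) => i ni.
  by rewrite /c' ni.
by rewrite /c' ltnNge ni mul0r.
Qed.

End gram_bound.

(** * The eigenfunctionals of the controlled equation *)

Section preliminaries.
Context {R : realType}.
Local Notation C := R[i].
Local Notation mu := (@lebesgue_measure R).
Local Notation mR D := (@measurable _ (measurableTypeR R) D).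

Lemma dense_eq0 (V : normedModType C) (l : V -> C^o) (A : set V) :
  bounded_linear l -> dense A -> (forall x, A x -> l x = 0) -> forall v, l v = 0.
Proof.
move=> bl dA lA v; apply: (@rnorm_le_eps _ C^o) => e e0.
have [K K0 lK] := bounded_linear_bound bl.
have eK : 0 < real_complex R (e / K) by rewrite ltcR divr_gt0.
have [|x [vx Ax]] := dA (ball v (real_complex R (e / K))) _ (ball_open _ _).
  by exists v; exact: ballxx.
move: vx; rewrite -ball_normE /= normrE_rnorm ltcR => /ltW vx.
have -> : l v = l (v - x) by rewrite (blinB bl) (lA x Ax) subr0.
by apply: le_trans (lK _) _; rewrite mulrC -ler_pdivlMr.
Qed.

(** 0 is a limit point of the whole plane. *)
Lemma discrete_neq_setT (E : set C^o) : limit_point E = set0 -> exists z, ~ E z.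
Proof.
move=> E0; apply: contrapT => H.
have ET z : E z by apply: contrapT => Ez; apply: H; exists z.
suff : limit_point E 0 by rewrite E0.
move=> U /nbhs_ballP[e /= e0 eU]; exists (e / 2); split => //.
  by rewrite gt_eqF// divr_gt0.
apply: eU; rewrite -ball_normE /= sub0r normrN gtr0_norm ?divr_gt0//.
by rewrite ltr_pdivrMr// ltr_pMr// ltr1n.
Qed.

Lemma in_L2_patch (s s' : R) (w u : R -> C) : in_L2 s w ->
  (forall t, 0 <= t -> t <= s -> u t = w t) -> (forall t, t < 0 \/ s < t -> u t = 0) ->
  in_L2 s' u.
Proof.
move=> [mr mi w2] uw u0.
have mI r : mR `[0, r] by exact: measurable_itv.
have uE t : t \in `[0%R, s]%classic -> u t = w t.
  by rewrite inE /= in_itv/= => /andP[t0 ts]; exact: uw.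
have uE0 t : t \notin `[0%R, s]%classic -> u t = 0.
  rewrite notin_setE /= in_itv/= => /negP; rewrite negb_and -!ltNge => /orP H.
  exact: u0.
have part (p : C -> R) : p 0 = 0 ->
    measurable_fun (`[0%R, s] : set (measurableTypeR R)) (fun t => p (w t)) ->
    measurable_fun (`[0%R, s'] : set (measurableTypeR R)) (fun t => p (u t)).
  move=> p0 mp.
  apply: (eq_measurable_fun ((fun t => p (w t)) \_ `[0%R, s])).
    by move=> t _; rewrite patchE; case: ifPn => [/uE|/uE0] ->.
  apply: (@measurable_restrict _ _ (measurableTypeR R) R _ _ _ (mI _) (mI _)).1.
  by apply: measurable_funS mp.
split; [exact: part|exact: part|].
apply: le_lt_trans w2; rewrite -[leRHS]mul1e.
apply: (ge0_integral_dominated _ (negligible_set0 mu)) => //.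
- by move=> x _; rewrite lee_fin sqr_ge0.
- by move=> x _; rewrite lee_fin sqr_ge0.
- move=> x Dx _; have [xs|/uE0 ux] := boolP (x \in `[0%R, s]%classic).
    by right; split; [exact/set_mem|rewrite mul1e uE].
  by left; rewrite ux [rnorm _](@rnorm0 _ C^o) expr0n.
Qed.

Lemma in_L2_cexp (s : R) (z c : C) :
  in_L2 s (fun t => cexp (z * real_complex R t) * c).
Proof.
suff : in_L2 s (fun t => cexp (z * real_complex R t)).
  by move=> /(in_L2Z c); under eq_fun do rewrite mulrC.
have mD : mR `[0, s] by exact: measurable_itv.
have muD : (mu `[0%R, s] < +oo)%E.
  by rewrite lebesgue_measure_itv/=; case: ifPn => // _; rewrite -EFinB ltry.
have cl (a : R) : continuous (fun t : R => a * t).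
  by move=> x; apply: cvgM; [exact: cvg_cst|exact: cvg_id].
have ce : continuous (fun t : R => expR (complex.Re z * t)).
  by move=> x; apply: (@continuous_comp _ _ _ _ expR); [exact: cl|exact: continuous_expR].
have cc : continuous (fun t : R => cos (complex.Im z * t)).
  by move=> x; apply: (@continuous_comp _ _ _ _ cos); [exact: cl|exact: continuous_cos].
have csn : continuous (fun t : R => sin (complex.Im z * t)).
  by move=> x; apply: (@continuous_comp _ _ _ _ sin); [exact: cl|exact: continuous_sin].
have meas (h : R -> R) : continuous h ->
    measurable_fun (`[0%R, s] : set (measurableTypeR R)) h.
  by move=> /continuous_measurable_fun; apply: measurable_funS.
have eE t : complex.Re (z * real_complex R t) = complex.Re z * t.
  by rewrite cReM /= mulr0 subr0.
have iE t : complex.Im (z * real_complex R t) = complex.Im z * t.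
  by rewrite cImM /= mulr0 add0r.
have cE t : cexp (z * real_complex R t) =
    Complex (expR (complex.Re z * t) * cos (complex.Im z * t))
            (expR (complex.Re z * t) * sin (complex.Im z * t)).
  by rewrite /cexp eE iE.
split.
- apply: (eq_measurable_fun
    (fun t => expR (complex.Re z * t) * cos (complex.Im z * t))).
    by move=> t _; rewrite cE.
  by apply: meas => x; apply: cvgM; [exact: ce|exact: cc].
- apply: (eq_measurable_fun
    (fun t => expR (complex.Re z * t) * sin (complex.Im z * t))).
    by move=> t _; rewrite cE.
  by apply: meas => x; apply: cvgM; [exact: ce|exact: csn].
have I : mu.-integrable `[0%R, s] (EFin \o (fun t => expR (complex.Re z * t) ^+ 2)).
  apply: (integrable_of_bound (M := expR (`|complex.Re z| * s) ^+ 2) mD muD).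
    by apply: measurable_funX; exact: meas.
  move=> t /=; rewrite in_itv/= => /andP[t0 ts].
  rewrite ger0_norm ?sqr_ge0// ler_pXn2r ?nnegrE ?expR_ge0// ler_expR.
  by rewrite (le_trans (ler_norm _))// normrM (ger0_norm t0) ler_wpM2l.
have /integrableP[_] := I; apply: le_lt_trans.
rewrite le_eqVlt; apply/orP; left; apply/eqP; apply: eq_integral => t _.
by rewrite rnorm_cabs cabs_cexp eE /= ger0_norm// sqr_ge0.
Qed.

Lemma cintegral_patch (t2 t : R) (g g0 : R -> C) : t2 <= t ->
  cintegrable `[0%R, t2] g0 ->
  (forall x, 0 <= x -> x <= t2 -> g x = g0 x) -> (forall x, t2 < x -> g x = 0) ->
  cintegrable `[0%R, t] g /\ cintegral `[0%R, t] g = cintegral `[0%R, t2] g0.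
Proof.
move=> t2t [i1 i2] gg0 g0'.
have mI r : mR `[0, r] by exact: measurable_itv.
have I2 : `[0%R, t]%classic `&` `[0%R, t2]%classic = `[0%R, t2]%classic.
  apply/seteqP; split => x /=; first by case.
  rewrite !in_itv/= => /andP[x0 xt]; split; rewrite x0 ?xt//.
  exact: le_trans xt t2t.
have part (p : C -> R) : p 0 = 0 ->
    {in `[0%R, t]%classic, (fun x => p (g x)) =1 (fun x => p (g0 x)) \_ `[0%R, t2]}.
  move=> p0 x /set_mem; rewrite /= in_itv/= => /andP[x0 xt].
  rewrite patchE mem_setE in_itv/= x0 /=; have [xt2|xt2] := leP x t2.
    by rewrite gg0.
  by rewrite g0'.
have pint (p : C -> R) : p 0 = 0 ->
    mu.-integrable `[0%R, t2] (EFin \o (fun x => p (g0 x))) ->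
    mu.-integrable `[0%R, t] (EFin \o (fun x => p (g x))).
  move=> p0; rewrite -{1}I2 => /(integrable_restrict _ (mI _) (mI _) _).1.
  apply: eq_integrable => //= x xt; rewrite part// restrict_EFin//.
split; first by split; apply: pint.
rewrite /cintegral; congr Complex; rewrite -[in RHS]I2 Rintegral_mkcondr;
  by apply: eq_Rintegral => x xt; rewrite part.
Qed.

End preliminaries.

Section controlled_equation.
Context {R : realType} {W X V : hilbertType R}.
Local Notation C := R[i].
Local Notation mu := (@lebesgue_measure R).
Local Notation mR D := (@measurable _ (measurableTypeR R) D).
Variables (S : R -> X -> X) (iW : W -> X) (iV : X -> V) (pair : V -> W -> C).
Variables (SV : R -> V -> V) (b : V).
Hypothesis S_semigroup : c0_semigroup S.
Hypothesis triple : pivot_triple (generator S) iW iV pair.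
Hypothesis SV_semigroup : c0_semigroup SV.
Hypothesis SV_extends : forall t x, 0 <= t -> SV t (iV x) = iV (S t x).

Lemma pair_bounded_linear w : bounded_linear ((fun v => pair v w) : V -> C^o).
Proof.
apply: (@bounded_linearI _ _ _ _ (rnorm w)) => [a v1 v2|v].
  exact: (pair_linear triple).
have := pair_bound triple v w; rewrite !normrE_rnorm -rmorphM /= normcE_cabs lecR.
by rewrite rnorm_cabs mulrC.
Qed.

Lemma pivot_bounded_linear w : bounded_linear ((fun x => pair (iV x) w) : X -> C^o).
Proof.
have [l1 c1] := pair_bounded_linear w; have [l2 c2] := iV_linear triple.
split=> [a x y|]; first by rewrite l2 l1.
move=> x; apply: (@continuous_comp _ _ _ iV (fun v => pair v w : C^o)).
  exact: c2.
exact: c1.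
Qed.

Section eigenvector.
Variables (lam : C) (psi : W).
Hypothesis spec : simple_point_spectrum (generator S).
Hypothesis lam_spec : spectrum (generator S) lam.
Hypothesis psi_eigen : adjoint (generator S) (iW psi) (Num.conj lam *: iW psi).

Lemma pair_generator x y : generator S x y ->
  pair (iV y) psi = lam * pair (iV x) psi.
Proof.
move=> /psi_eigen; rewrite -(pair_pivot triple) => ->.
have lW := iW_linear triple; have anti := pair_antilinear triple (iV x).
have p0 : pair (iV x) 0 = 0.
  have := anti 1 0 0; rewrite scale1r addr0 rmorph1 mul1r => /eqP.
  by rewrite -subr_eq0 opprD addNKr oppr_eq0 => /eqP.
by rewrite -(blinZ lW) -(pair_pivot triple) -[X in pair _ X]addr0 anti conjCK p0 addr0.
Qed.

(** A resolvent point exists because a spectrum with no limit point is not the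
    whole plane. *)
Lemma pair_semigroup t x : 0 <= t ->
  pair (iV (S t x)) psi = cexp (lam * real_complex R t) * pair (iV x) psi.
Proof.
move=> t0; have [z zE] := discrete_neq_setT (spectrum_discrete spec).
have zr : resolvent_set (generator S) z by apply: contrapT => H; apply: zE.
apply: (eigenfunctional_semigroup (L := fun x => pair (iV x) psi) S_semigroup
  (pivot_bounded_linear psi) pair_generator x zr) => //.
by apply/eqP => zl; apply: zE; rewrite zl.
Qed.

(** Both sides are bounded functionals of [v] that agree on the dense image of
    [X]. *)
Lemma pair_extended_semigroup t v : 0 <= t ->
  pair (SV t v) psi = cexp (lam * real_complex R t) * pair v psi.
Proof.
move=> t0; apply/eqP; rewrite -subr_eq0; apply/eqP.
have [K1 K10 lK1] := bounded_linear_bound (pair_bounded_linear psi).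
have [K2 K20 SK2] := bounded_linear_bound (c0_bounded SV_semigroup t0).
pose l (v : V) : C^o := pair (SV t v) psi - cexp (lam * real_complex R t) * pair v psi.
apply: (@dense_eq0 _ _ l (range iV)); last 2 first.
- exact: iV_dense triple.
- move=> _ [x _ <-]; rewrite /l SV_extends// pair_semigroup// subrr//.
have [lSV _] := c0_bounded SV_semigroup t0.
have scaleE (x y : C) : x *: (y : C^o) = x * y by [].
apply: (@bounded_linearI _ _ _ _
  (K1 * K2 + cabs (cexp (lam * real_complex R t)) * K1)) => [a u w|u].
  by rewrite /l lSV !(pair_linear triple) scaleE; ring.
rewrite /l rnorm_cabs (le_trans (cabsD _ _))// cabsN cabsM mulrDl lerD//.
  by apply: le_trans (lK1 _) _; rewrite -mulrA ler_pM2l.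
by rewrite -mulrA ler_wpM2l ?cabs_ge0// -rnorm_cabs.
Qed.

Let F (t : R) := cexp (- lam * real_complex R t) * pair b psi.

(** The control enters the eigencomponents of the mild solution through its
    moments against the exponentials. *)
Lemma control_moment (u : R -> C) (t2 t : R) (v : V) : t2 <= t -> 0 <= t2 ->
  in_L2 t2 u -> {ae mu, forall x, t2 <= x -> u x = 0} ->
  is_control_integral SV b u t v ->
  pair v psi = cexp (lam * real_complex R t) * cintegral `[0%R, t2] (fun x => F x * u x).
Proof.
move=> t2t t20 uL u0 uv.
have mI r : mR `[0, r] by exact: measurable_itv.
have muD r : (mu `[0%R, r] < +oo)%E.
  by rewrite lebesgue_measure_itv/=; case: ifPn => // _; rewrite -EFinB ltry.
have FL : in_L2 t2 F by exact: in_L2_cexp.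
have I := L2_mul_integrable FL uL.
pose g x := if x <= t2 then cexp (lam * real_complex R t) * (F x * u x) else 0.
have [|x xt2|gI gE] := cintegral_patch (g := g) t2t
  (cintegrableZ (mI t2) (cexp (lam * real_complex R t)) I).
- by move=> x _ xt2; rewrite /g xt2.
- by rewrite /g leNgt xt2.
rewrite -cintegralZ// -gE.
apply: (bochner_functional (pair_bounded_linear psi) (mI t) (muD t) uv gI u0).
move=> x /=; rewrite in_itv/= => /andP[x0 xt] /contrapT ux.
have tx : 0 <= t - x by rewrite subr_ge0.
rewrite /g; case: leP => xt2; last first.
  rewrite (ux (ltW xt2)) scale0r (blin0 (c0_bounded SV_semigroup tx)).
  exact: (blin0 (pair_bounded_linear psi)).
rewrite pair_extended_semigroup// (blinZ (pair_bounded_linear psi)).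
rewrite -[_ *: _]/(_ * _) /F rmorphB mulrBr cexpD -mulNr /=; ring.
Qed.

End eigenvector.
End controlled_equation.

(** * Null-controllability and minimality *)

(** Integration against the dual function [u] is continuous for the L2 norm; it
    vanishes on the span of the other functions and not at [F j]. *)
Lemma biorthogonal_minimal (R : realType) (s : R) (F : nat -> R -> R[i]) :
  (forall j, in_L2 s (F j)) ->
  (forall j, exists2 u, in_L2 s u &
     (forall k, k != j -> cintegral `[0%R, s] (fun t => F k t * u t) = 0) /\
     cintegral `[0%R, s] (fun t => F j t * u t) != 0) ->
  L2minimal s F.
Proof.
move=> FL dual j Fj; have [u uL [u0 uj]] := dual j.
have mD : @measurable _ (measurableTypeR R) `[0%R, s] by exact: measurable_itv.
set c := cintegral _ _ in uj; have c0 := cabs_gt0 uj; set del := cabs c in c0.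
have U0 := L2sqr_ge0 s u; set U := L2sqr s u in U0.
(* In the estimate of [c] weighted by [e], the term in [u] is at most [del / 2];
   the tolerance [eps] makes the other one at most [del / 4]. *)
pose e := del / (2 * (U + 1)).
have e0 : 0 < e by rewrite divr_gt0// mulr_gt0// ltr_wpDl.
pose eps := Num.min 1 (e * (del / 4)).
have ed0 : 0 < e * (del / 4) by rewrite mulr_gt0// divr_gt0.
have eps0 : 0 < eps by rewrite lt_min ltr01.
have [g [n [a [f [fF gE]]]] /(L2sqr_lt_of_norm eps0) He] := Fj eps eps0.
have fL i : in_L2 s (f i) by have [k _ <-] := fF i.
have gL : in_L2 s g by rewrite gE; apply: in_L2_sum => i _; apply: in_L2Z.
have gu : cintegral `[0%R, s] (fun t => g t * u t) = 0.
  have I i : true -> cintegrable `[0%R, s] (fun t => a i * (f i t * u t)).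
    by move=> _; apply: cintegrableZ => //; exact: L2_mul_integrable.
  rewrite (eq_cintegral (g := fun t => \sum_(i < n) a i * (f i t * u t))).
    rewrite (cintegral_sum mD _ I) big1// => i _.
    rewrite cintegralZ//; last exact: L2_mul_integrable.
    by have [k /= kj <-] := fF i; rewrite u0 ?mulr0.
  by move=> t _; rewrite gE mulr_suml; apply: eq_bigr => i _; rewrite mulrA.
have dE : cintegral `[0%R, s] (fun t => (F j t - g t) * u t) = c.
  rewrite -[RHS]subr0 -gu -(cintegralB mD); try exact: L2_mul_integrable.
  by apply: eq_cintegral => t _; rewrite mulrBl.
have ei0 : 0 < e^-1 by rewrite invr_gt0.
have := cabs_cintegral_mul (in_L2B (FL j) gL) uL ei0.
rewrite dE -/del invrK -/U.
have eU : e * U <= del / 2.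
  rewrite /e mulrAC ler_pdivrMr ?mulr_gt0 ?ltr_wpDl//.
  rewrite (_ : del / 2 * (2 * (U + 1)) = del * U + del); last by field.
  by rewrite lerDl ltW.
have ee : eps ^+ 2 <= e * (del / 4).
  apply: le_trans (_ : eps <= _); last by rewrite ge_min lexx orbT.
  by rewrite expr2 ger_pMl// ge_min lexx.
have : e^-1 * L2sqr s (fun t => F j t - g t) <= del / 4.
  by rewrite ler_pdivrMl// (le_trans (ltW He)).
lra.
Qed.

Lemma uniform_pointwise (T : choiceType) (U : uniformType) (A : set T)
    (f : nat -> T -> U) (g : T -> U) (t : T) : A t ->
  {uniform A, f @ \oo --> g} -> f n t @[n --> \oo] --> g t.
Proof.
move=> At /(@uniform_subset_cvg _ _ g A [set t]) H.
have : {uniform [set t], f @ \oo --> g} by apply: H => x ->.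
by rewrite uniform_set1.
Qed.

Theorem theorem1 (R : realType) (W X V : hilbertType R)
  (S : R -> X -> X) (A : opgraph X)
  (iW : W -> X) (iV : X -> V) (pair : V -> W -> R[i])
  (SV : R -> V -> V) (b : V)
  (lam : nat -> R[i]) (phi : nat -> X) (psi : nat -> W) (T t1 : R)
  (X_separable : separable_space X)
  (S_semigroup : c0_semigroup S)
  (A_generator : A = generator S)
  (triple : pivot_triple A iW iV pair)
  (SV_semigroup : c0_semigroup SV)
  (SV_extends : forall t x, 0 <= t -> SV t (iV x) = iV (S t x))
  (b_admissible : admissible iV SV b)
  (A_spectrum : simple_point_spectrum A)
  (lam_inj : injective lam)
  (lam_range : range lam = spectrum A)
  (lam_order : forall i j : nat, (i <= j)%N -> `|lam i| <= `|lam j|)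
  (phi_eigen : forall j, A (phi j) (lam j *: phi j))
  (psi_eigen : forall j,
     adjoint A (iW (psi j)) (Num.conj (lam j) *: iW (psi j)))
  (biorthogonal : forall k j, hdot (phi k) (iW (psi j)) = (k == j)%:R)
  (T_ge0 : 0 <= T)
  (A_expansion : eigen_expansion S phi T)
  (T_lt_t1 : T < t1) :
  let F := fun (j : nat) (t : R) =>
    cexp (- lam j * real_complex R t) * pair b (psi j) in
  (null_controllable S iV SV b t1 (t1 - T) -> L2minimal (t1 - T) F) /\
  (L2strongly_minimal (t1 - T) F ->
   (forall x0 : X,
      (\sum_(0 <= j <oo) ((rnorm (hdot x0 (iW (psi j)) : R[i]^o)) ^+ 2)%:E
         < +oo)%E) ->
   null_controllable S iV SV b t1 (t1 - T)).
Proof.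
move=> F; subst A; set s := t1 - T.
have s0 : 0 < s by rewrite subr_gt0.
have st1 : s <= t1 by rewrite gerBl.
have lam_spec j : spectrum (generator S) (lam j) by rewrite -lam_range; exists j.
have moment j u t v : s <= t -> in_L2 s u ->
    {ae lebesgue_measure, forall x, s <= x -> u x = 0} ->
    is_control_integral SV b u t v ->
    pair v (psi j) = cexp (lam j * real_complex R t) *
      cintegral `[0%R, s] (fun x => F j x * u x).
  move=> st; exact: (control_moment S_semigroup triple SV_semigroup SV_extends
    A_spectrum (lam_spec j) (psi_eigen j) st (ltW s0)).
have pairS j := pair_semigroup S_semigroup triple A_spectrum (lam_spec j) (psi_eigen j).
have FL j : in_L2 s (F j) by exact: in_L2_cexp.
have piv := pair_pivot triple; have lV := iV_linear triple.
have lp j := pair_bounded_linear triple (psi j).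
have t1_ge0 : 0 <= t1 := ltW (le_lt_trans T_ge0 T_lt_t1).
split.
  (* The opposites of the controls that steer the [phi j] to zero are
     biorthogonal to [F]. *)
  move=> ctrl; apply: biorthogonal_minimal => // j.
  have [u [uL u0 [v uv]]] := ctrl (phi j).
  rewrite (blin0 lV) => /eqP; rewrite eq_sym addrC addr_eq0 => /eqP vE.
  have mom k : cintegral `[0%R, s] (fun t => F k t * u t) = - (j == k)%:R.
    apply: (mulfI (cexp_neq0 (lam k * real_complex R t1))).
    rewrite -(moment k u t1 v st1 uL u0 uv) vE.
    rewrite -scaleN1r (blinZ (lp k)) pairS// piv biorthogonal.
    by rewrite -[_ *: _]/(_ * _) mulN1r mulrN.
  exists u => //; split=> [k kj|]; rewrite mom.
    by rewrite eq_sym (negbTE kj) oppr0.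
  by rewrite eqxx oppr_eq0 oner_eq0.
move=> strong summable x0.
have [gam gam0 riesz] := gram_riesz FL strong.
pose a j : R[i] := - hdot x0 (iW (psi j)).
have [M aM] : exists M : R, forall n, \sum_(i < n) cabs (a i) ^+ 2 <= M.
  have := summable x0; set Sigma := (\sum_(0 <= j <oo) _)%E => SigE.
  have q0 j : (0 <= ((rnorm (hdot x0 (iW (psi j)) : R[i]^o)) ^+ 2)%:E)%E.
    by rewrite lee_fin sqr_ge0.
  exists (fine Sigma) => n.
  rewrite -lee_fin fineK ?ge0_fin_numE//; last by apply: nneseries_ge0 => j _ _.
  have := nneseries_lim_ge n (m := 0) (P := xpredT) (fun j _ _ => q0 j).
  apply: le_trans; rewrite big_mkord -sumEFin.
  by apply: lee_sum => i _; rewrite /a cabsN.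
have [w wL wa] := moment_problem gam0 FL riesz aM.
pose u t := if (0 <= t) && (t <= s) then Num.conj (w t) else 0.
have uE t : 0 <= t -> t <= s -> u t = Num.conj (w t).
  by move=> t0' ts; rewrite /u t0' ts.
have uE0 t : t < 0 \/ s < t -> u t = 0.
  by rewrite /u !ltNge => -[|] /negbTE ->; rewrite ?andbF.
have uL r : in_L2 r u by exact: in_L2_patch (in_L2_conj wL) uE uE0.
have u0 : {ae lebesgue_measure, forall t, s <= t -> u t = 0}.
  exists [set s]; split; [exact: measurable_set1|exact: lebesgue_measure_set1|].
  move=> t /= H; apply: contrapT => /eqP ts; apply: H => st; apply: uE0; right.
  by rewrite lt_neqAle eq_sym ts.
have [x1 ux1] := b_admissible u s (fun r _ => uL r) (ltW s0).
(* [z] is the state at time [s], when the control is switched off. *)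
pose z := S s x0 + x1.
have zj j : pair (iV z) (psi j) = 0.
  rewrite /z (blinD lV) (blinD (lp j)) pairS ?(ltW s0)//.
  rewrite (moment j u s _ (lexx s) (uL s) u0 ux1).
  have -> : cintegral `[0%R, s] (fun x => F j x * u x) = a j.
    rewrite -(wa j); apply: eq_cintegral => t /=.
    by rewrite in_itv/= => /andP[t0' ts]; rewrite uE.
  by rewrite /a piv mulrN subrr.
have van r : 0 < r -> S (T + r) z = 0.
  move=> r0; have [c cz] := A_expansion z.
  have Tr : T < T + r / 2 by rewrite ltrDl divr_gt0.
  have rr : T + r / 2 < T + r by rewrite ltrD2l ltr_pdivrMr// ltr_pMr// ltr1n.
  have mem : `[T + r / 2, T + r]%classic (T + r).
    by rewrite /= in_itv/= lexx ltW.
  have lim_n := uniform_pointwise mem (cz _ _ Tr rr).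
  have Tr0 : 0 <= T + r by rewrite addr_ge0// ltW.
  (* The coefficients of the expansion of [S (T + r) z] are its products with the
     [psi i]. *)
  have c0 i : c i (T + r) = 0.
    have := blin_cvg (pivot_bounded_linear triple (psi i)) lim_n.
    rewrite pairS// zj mulr0 => H.
    have H' : (pair (iV (\sum_(j < n) c j (T + r) *: phi j)) (psi i) : R[i]^o)
        @[n --> \oo] --> (c i (T + r) : R[i]^o).
      apply/cvg_rnormP => e e0; exists i.+1 => // n /= ni.
      suff -> : pair (iV (\sum_(j < n) c j (T + r) *: phi j)) (psi i) = c i (T + r).
        by rewrite subrr rnorm0.
      have bp := pivot_bounded_linear triple (psi i).
      rewrite (blin_sum bp) (bigD1 (Ordinal ni))//= (blinZ bp) piv biorthogonal eqxx.
      rewrite big1 ?addr0 => [|j ji]; first by rewrite -[_ *: _]/(_ * _) mulr1.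
      rewrite (blinZ bp) piv biorthogonal (_ : (j == i :> nat) = false) ?scaler0//.
      exact/negbTE.
    exact: cvg_unique_rnorm H' (H _).
  apply: (cvg_unique_rnorm lim_n).
  rewrite (_ : (fun n => _) = (fun=> 0)); first exact: cvg_cst.
  by apply/funext => n; rewrite big1// => i _; rewrite c0 scale0r.
(* The expansion is available after time [T] only; continuity at 0 reaches [T]. *)
have STz : S T z = 0.
  have := c0_cont S_semigroup (x := S T z) => H.
  apply: (cvg_unique_rnorm H); apply/cvg_rnormP => e e0.
  near=> r; have r0 : 0 < r by near: r; exact: nbhs_right_gt.
  by rewrite -(c0_add S_semigroup _ (ltW r0) T_ge0) [r + T]addrC van// subrr rnorm0.
exists u; split => //; exists (SV T (iV x1)).
  apply: (bochner_image (c0_bounded SV_semigroup T_ge0) st1 ux1) => t t0' ts.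
    rewrite -(c0_add SV_semigroup) ?subr_ge0//; congr (SV _ _).
    by rewrite /s; ring.
  rewrite uE0; last by right.
  by rewrite scale0r (blin0 (c0_bounded SV_semigroup _)) ?subr_ge0.
rewrite SV_extends// -(blinD lV) (_ : t1 = T + s); last by rewrite /s; ring.
by rewrite (c0_add S_semigroup)// ?(ltW s0)// -(blinD (c0_bounded S_semigroup T_ge0)) STz.
Unshelve. all: by end_near. Qed.
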